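(* Let $G$ be a second-countable topological group equipped with a right-invariant compatible metric $d$. Suppose that there exists a sequence $(\mu_n)_{n\in\mathbb{N}}$ of Borel probability measures on $G$ with compact supports $K_n := \operatorname{spt}\mu_n$ ($n\in\mathbb{N}$) such that (A) $(\mu_n)_{n\in\mathbb{N}}$ converges to invariance in the mass transportation distance over $d$, i.e., $d_{\mathrm{MT}}((\lambda_g)_*(\mu_n),\mu_n)\to 0$ as $n\to\infty$ for every $g\in G$, where $\lambda_g\colon G\to G,\ x\mapsto gx$; (B) the sequence of $mm$-spaces $(K_n, d|_{K_n\times K_n}, \mu_n|_{\mathcal{B}(K_n)})_{n\in\mathbb{N}}$ concentrates to a fully supported, compact $mm$-space $(X,d_X,\mu_X)$. Then there exists a topological embedding $\psi\colon X\to \mathrm{S}(G)$ into the Samuel compactification of $G$ such that the push-forward measure $\psi_*(\mu_X)$ is $G$-invariant. In particular, $\psi(X)$ is a $G$-invariant subspace of $\mathrm{S}(G)$.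
   Context: Topological groups are Hausdorff. A metric is compatible if it generates the topology. $\mathcal{B}(X)$ denotes the Borel $\sigma$-algebra of $X$ and $\mathrm{P}(X)$ the set of Borel probability measures on $X$. The support $\operatorname{spt}\mu$ of a Borel probability measure $\mu$ is the closed set of all points each of whose open neighborhoods has positive $\mu$-measure. (On a second-countable space, $\mu(\operatorname{spt}\mu)=1$, so the restriction of $\mu$ to $\mathcal{B}(\operatorname{spt}\mu)$ is a probability measure.) The push-forward is $f_*(\mu)(B)=\mu(f^{-1}(B))$. Mass transportation distance over a (pseudo-)metric $d$ on $X$: for $\mu,\nu\in \mathrm{P}(X)$, $$d_{\mathrm{MT}}(\mu,\nu) := \sup\left\{\left|\int f\,d\mu-\int f\,d\nu\right| : f\colon X\to[-1,1]\ \text{is 1-Lipschitz with respect to } d\right\}.$$ An $mm$-space is a triple $(X,d,\mu)$ where $(X,d)$ is a separable complete metric space and $\mu$ is a Borel probability measure on $X$; it is compact if $(X,d)$ is compact, and fully supported if $\operatorname{spt}\mu=X$. Let $\lambda$ be Lebesgue measure on $[0,1)$. A parametrization of $(X,d,\mu)$ is a Borel map $\varphi\colon[0,1)\to X$ with $\varphi_*(\lambda)=\mu$ (these always exist). For Borel functions $f,g\colon [0,1)\to\mathbb{R}$ let $\mathrm{me}_\lambda(f,g):=\inf\{\varepsilon>0 : \lambda(\{t : |f(t)-g(t)|>\varepsilon\})\le\varepsilon\}$, and let $(\mathrm{me}_\lambda)_{\mathrm{H}}$ be the associated Hausdorff distance between sets of Borel functions, i.e., $(\mathrm{me}_\lambda)_{\mathrm{H}}(A,B)=\inf\{\varepsilon>0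 : $ every element of $B$ is at $\mathrm{me}_\lambda$-distance $<\varepsilon$ from some element of $A$, and vice versa$\}$. Let $\mathrm{Lip}_1(X)$ be the set of 1-Lipschitz functions $X\to\mathbb{R}$. Gromov's observable distance between $mm$-spaces is $$d_{\mathrm{conc}}(X,Y):=\inf\{(\mathrm{me}_\lambda)_{\mathrm{H}}(\mathrm{Lip}_1(X)\circ\varphi,\mathrm{Lip}_1(Y)\circ\psi) : \varphi \text{ a parametrization of } X,\ \psi\text{ a parametrization of } Y\}.$$ A sequence of $mm$-spaces $(X_n)$ concentrates to an $mm$-space $X$ if $d_{\mathrm{conc}}(X_n,X)\to0$. The right uniformity of $G$ is generated by the entourages $\{(x,y)\in G\times G: yx^{-1}\in U\}$, $U$ a neighborhood of the neutral element. $\mathrm{RUCB}(G)$ is the Banach algebra (supremum norm) of bounded real-valued functions on $G$ that are uniformly continuous with respect to the right uniformity. The Samuel compactification $\mathrm{S}(G)$ is the set of all unital ring homomorphisms $\mathrm{RUCB}(G)\to\mathbb{R}$, with the topology of pointwise convergence on $\mathrm{RUCB}(G)$; it is a compact Hausdorff space on which $G$ acts continuously by $(g\xi)(f):=\xi(f\circ\lambda_g)$ for $g\in G$, $\xi\in \mathrm{S}(G)$, $f\in\mathrm{RUCB}(G)$. A Borel measure on $\mathrm{S}(G)$ is $G$-invariant if it equals its push-forward under $\xi\mapsto g\xi$ for every $g\in G$. *)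

(* Defs.v *)
From HB Require Import structures.
From mathcomp Require Import all_boot all_order all_algebra.
From mathcomp Require Import all_classical all_reals all_analysis.

Set Implicit Arguments.
Unset Strict Implicit.
Unset Printing Implicit Defensive.

Import Order.TTheory GRing.Theory Num.Theory.
Import numFieldNormedType.Exports.

Local Open Scope classical_set_scope.
Local Open Scope ring_scope.

(* Points are required only because measurable types are pointed. *)
#[short(type="pmetricType")]
HB.structure Definition PointedMetric (R : numDomainType) :=
  {T of Metric R T & Pointed T}.

#[short(type="completeMetricType")]
HB.structure Definition CompleteMetric (R : numDomainType) :=
  {T of Metric R T & Complete T}.

HB.structure Definition PrePTopologicalGroup :=
  {G of PointedTopological G & Group G}.

HB.mixin Record isTopologicalGroup G & PrePTopologicalGroup G := {
  mulg_continuous : continuous (fun x : G * G => (x.1 * x.2)%g) ;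
  invg_continuous : continuous (fun x : G => (x^-1)%g)
}.

#[short(type="topologicalGroupType")]
HB.structure Definition TopologicalGroup :=
  {G of PrePTopologicalGroup G & isTopologicalGroup G}.

(* A topological group equipped with a compatible metric: the balls of mdist
   generate the (hence Hausdorff) group topology. *)
#[short(type="metricGroupType")]
HB.structure Definition MetricGroup (R : numDomainType) :=
  {G of Metric R G & TopologicalGroup G}.

Definition right_invariant_metric (R : realType) (G : metricGroupType R) :=
  forall x y g : G, mdist (x * g)%g (y * g)%g = mdist x y.

Notation borel T := (g_sigma_algebraType (@open T)).

Lemma continuous_borel (S T : ptopologicalType) (f : S -> T) :
  continuous f -> measurable_fun [set: borel S] (f : borel S -> borel T).
Proof.
move=> /continuousP cf; apply: (@measurability _ _ (borel S) (borel T) setT f open) => //.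
move=> _ [U oU <-]; rewrite setTI; apply: sub_sigma_algebra; exact: cf.
Qed.

Section left_translation.
Context {G : topologicalGroupType}.

Definition ltrans (g : G) : borel G -> borel G := fun x => (g * x)%g.

Lemma ltrans_continuous g : continuous (ltrans g : G -> G).
Proof.
move=> x; apply: (@continuous_comp _ _ _ (fun y : G => (g, y))
  (fun z : G * G => (z.1 * z.2)%g)); last exact: mulg_continuous.
by apply: cvg_pair => /=; [exact: cvg_cst|exact: cvg_id].
Qed.

HB.instance Definition _ g := @isMeasurableFun.Build _ _ _ _ (ltrans g)
  (continuous_borel (@ltrans_continuous g)).

End left_translation.

Definition spt (R : realType) (T : ptopologicalType)
    (mu : probability (borel T) R) : set T :=
  [set x | forall U : set T, open_nbhs x U -> (0 < mu U)%E].

Definition lip1 (R : realType) (X : metricType R) : set (X -> R) :=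
  [set f | forall x y, `|f x - f y| <= mdist x y].
Arguments lip1 {R} X.

Definition d_MT (R : realType) (X : pmetricType R)
    (mu nu : probability (borel X) R) : R :=
  sup [set `|\int[mu]_x f x - \int[nu]_x f x| |
       f in [set f | lip1 X f /\ forall x, -1 <= f x <= 1]].

Definition separable (T : topologicalType) :=
  exists2 D : set T, countable D & dense D.

Record mmSpace (R : realType) := MMSpace {
  mm_carrier :> completeMetricType R ;
  mm_measure : probability (borel mm_carrier) R ;
  mm_separable : separable mm_carrier }.

Definition mm_compact (R : realType) (X : mmSpace R) :=
  compact [set: X].
Definition fully_supported (R : realType) (X : mmSpace R) :=
  spt (mm_measure X) = [set: X].

Section concentration.
Context {R : realType}.
Local Notation lambda := (@lebesgue_measure R).
Local Notation I := (`[0%R, 1%R[%classic : set R).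
Implicit Types (f g : R -> R) (A B : set (R -> R)) (X Y : mmSpace R).

(* A map on [0, 1) is represented by a map on R whose values outside [0, 1)
   are never used. *)
Definition parametrization X (phi : R -> X) :=
  measurable_fun I (phi : R -> borel X) /\
  forall B : set (borel X), measurable B ->
    lambda (I `&` phi @^-1` B) = mm_measure X B.

Definition me f g : R :=
  inf [set e : R | 0 < e /\
    (lambda (I `&` [set t | (`|f t - g t| > e)%R])%classic <= e%:E)%E].

Definition me_hausdorff A B : R :=
  inf [set e : R | [/\ 0 < e,
    forall g, B g -> exists2 f, A f & me f g < e &
    forall f, A f -> exists2 g, B g & me f g < e]].

(* The infimum is taken in the extended reals; it is over a nonempty set, as
   parametrizations always exist. *)
Definition d_conc X Y : \bar R :=
  ereal_inf [set r | exists phi psi,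
    [/\ parametrization (X := X) phi, parametrization (X := Y) psi &
    r = (me_hausdorff [set f \o phi | f in lip1 X]
                      [set g \o psi | g in lip1 Y])%:E]].

Definition concentrates (Xn : nat -> mmSpace R) X :=
  d_conc (Xn n) X @[n --> \oo] --> 0%E.

End concentration.
Arguments parametrization {R} X phi.

Section measure_of_support.
Context {R : realType} {T : ptopologicalType} (mu : probability (borel T) R).

Lemma closed_spt : closed (spt mu).
Proof.
move=> x clx U [oU Ux].
have [y [sy Uy]] := clx U (open_nbhs_nbhs (conj oU Ux)).
exact: sy.
Qed.

Lemma open_borel (U : set T) : open U -> measurable (U : set (borel T)).
Proof. by move=> oU; rewrite /measurable/=; apply: sub_sigma_algebra. Qed.

Lemma closed_borel (C : set T) : closed C -> measurable (C : set (borel T)).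
Proof.
by move=> cC; rewrite -(setCK C); apply: measurableC; apply: open_borel;
  exact: closed_openC.
Qed.

Lemma measure_spt : second_countable (T := T) -> mu (spt mu) = 1%E.
Proof.
move=> [B /countable_injP[f injf] [oB bB]].
pose F n : set T := \bigcup_(U in [set U | [/\ B U, mu U = 0%E & f U = n]]) U.
have F0 n : mu.-negligible (F n : set (borel T)).
  have [[U [BU mU fU]]|nU] := pselect (exists U, [/\ B U, mu U = 0%E & f U = n]).
    exists U; split => //; first by apply: open_borel; exact: oB.
    move=> x [V [BV _ fV] Vx]; have <- // : V = U.
    by apply: injf; rewrite ?inE// fV fU.
  suff -> : F n = set0 by exact: negligible_set0.
  by apply/seteqP; split => // x [U H _]; apply: nU; exists U.
have /negligibleP : mu.-negligible (~` spt mu : set (borel T)).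
  apply: negligibleS (negligible_bigcup F0) => x.
  move=> /existsNP[U /not_implyP[[oU Ux] /negP]].
  rewrite -leNgt => U0.
  have [V [BV Vx] VU] := bB x U (open_nbhs_nbhs (conj oU Ux)).
  exists (f V) => //; exists V => //; split => //.
  apply/eqP; rewrite eq_le measure_ge0 andbT (le_trans _ U0)//.
  by apply: le_measure; rewrite ?inE//; apply: open_borel => //; exact: oB.
have ms : measurable (spt mu : set (borel T)) by apply: closed_borel; exact: closed_spt.
move=> /(_ (measurableC ms)) sC0.
by rewrite -(setCK (spt mu)) probability_setC ?sC0 ?sube0//; exact: measurableC.
Qed.

Lemma spt_neq0 : second_countable (T := T) -> spt mu !=set0.
Proof.
move=> /measure_spt s1; apply/set0P/eqP => s0.
by move: s1; rewrite s0 measure0 => /eqP; rewrite eq_sym onee_eq0.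
Qed.

End measure_of_support.

Definition metric_sub (T : ptopologicalType) (K : set T)
  (cK : compact K) (K0 : K !=set0) : Type := set_type K.

Section metric_sub.
Context {R : realType} {T : pmetricType R}.
Variables (K : set T) (cK : compact K) (K0 : K !=set0).
Local Notation S := (metric_sub cK K0).

HB.instance Definition _ := PseudoMetric.copy S (set_type K).

Let S_point : S :=
  let: exist x Kx := cid K0 in SigSub (mem_set Kx).
HB.instance Definition _ := isPointed.Build S S_point.

Let dist (x y : S) : R := mdist (set_val x : T) (set_val y).

Let dist_ge0 x y : 0 <= dist x y. Proof. exact: mdist_ge0. Qed.

Let dist_positivity x y : dist x y = 0 -> x = y.
Proof. by move=> /mdist_positivity; exact: val_inj. Qed.

Let ballEdist (x : S) d : ball x d = [set y | dist x y < d].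
Proof.
apply/seteqP; split => y; rewrite /ball/=/initial_ball/=;
by rewrite ballEmdist.
Qed.

HB.instance Definition _ :=
  @PseudoMetric_isMetric.Build R S dist dist_ge0 dist_positivity ballEdist.

Lemma metric_sub_compact : compact [set: S].
Proof.
move=> F PF _.
pose F' : set_system T := (set_val : S -> T) @ F.
have F'K : F' K.
  by apply: (@filterS _ F _ setT) => [x _|]; [exact: set_valP|exact: filterT].
have [x [Kx clx]] := cK (_ : ProperFilter F') F'K.
exists (SigSub (mem_set Kx)); split => // A B FA.
move=> [_ [[C oC <-] Cx CB]].
have FA' : F' (set_val @` A) by apply: (@filterS _ F _ A) => // z Az; exists z.
have [y [Ay Cy]] := clx _ _ FA' (open_nbhs_nbhs (conj oC Cx)).
by case: Ay Cy => z Az <- Cz; exists z; split => //; exact: CB.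
Qed.

Let S_complete (F : set_system S) : ProperFilter F -> cauchy F -> cvg F.
Proof.
move=> PF cF; apply: (@compact_cauchy_cvg S setT) => //; last first.
  exact: metric_sub_compact.
exact: filterT.
Qed.
HB.instance Definition _ := Uniform_isComplete.Build S S_complete.

Lemma metric_sub_separable : separable S.
Proof.
have [B cB [oB bB]] := compact_second_countable metric_sub_compact.
pose f (U : set S) : S := xget point U.
exists (f @` B); first by apply: sub_countable cB; exact: card_image_le.
move=> O [x Ox] oO.
have [V [BV Vx] VO] := bB x O (open_nbhs_nbhs (conj oO Ox)).
exists (f V); split; last by exists V.
by apply: VO; exact: (xgetI point Vx).
Qed.

Lemma metric_sub_measurable (B : set (borel S)) : measurable B ->
  measurable (set_val @` B : set (borel T)).
Proof.
have mK : measurable (K : set (borel T)).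
  apply: closed_borel; apply: compact_closed => //; exact: metric_hausdorff.
rewrite [X in X B -> _](_ : _ = preimage_set_system [set: S] set_val
    (@measurable _ (borel T))); last first.
  rewrite -g_sigma_preimageE; congr (<<s _ >>).
  apply/seteqP; split => U.
    by move=> [C oC <-]; exists C; rewrite ?setTI.
  by move=> [C oC <-]; exists C; rewrite ?setTI.
move=> [C mC <-]; rewrite setTI.
rewrite (_ : _ @` _ = C `&` K); first exact: measurableI.
apply/seteqP; split => [_ [x Cx <-]|x [Cx Kx]].
  by split => //; exact: set_valP.
by exists (SigSub (mem_set Kx)).
Qed.

Section restricted_measure.
Variables (mu : probability (borel T) R) (muK : mu K = 1%E).

Definition prob_sub & mu K = 1%E : set (borel S) -> \bar R :=
  fun B => mu (set_val @` B).
Local Notation nu := (prob_sub muK).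

Let prob_sub0 : nu set0 = 0%E.
Proof. by rewrite /prob_sub image_set0 measure0. Qed.

Let prob_sub_ge0 B : (0 <= nu B)%E. Proof. exact: measure_ge0. Qed.

Let prob_sub_sigma_additive : semi_sigma_additive nu.
Proof.
move=> F mF tF mUF; rewrite /prob_sub image_bigcup.
apply: measure_semi_sigma_additive.
- by move=> n; exact: metric_sub_measurable.
- apply/trivIsetP => i j _ _ ij; apply/seteqP; split => // _ [[x Fx <-]].
  move=> [y Fy /val_inj yx]; move: Fy; rewrite yx => Fy.
  have /trivIsetP/(_ i j Logic.I Logic.I ij)/seteqP[+ _] := tF.
  by apply; split; [exact: Fx|exact: Fy].
- by rewrite -image_bigcup; exact: metric_sub_measurable.
Qed.

HB.instance Definition _ := isMeasure.Build _ _ _ nu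
  prob_sub0 prob_sub_ge0 prob_sub_sigma_additive.

Let prob_sub_setT : nu setT = 1%E.
Proof.
rewrite /prob_sub -[RHS]muK; congr (mu _).
apply/seteqP; split => [_ [x _ <-]|x Kx]; first exact: set_valP.
by exists (SigSub (mem_set Kx)).
Qed.

HB.instance Definition _ :=
  Measure_isProbability.Build _ _ _ nu prob_sub_setT.

End restricted_measure.
End metric_sub.

Section mm_of_support.
Context {R : realType} {T : pmetricType R}.
Variables (T2 : second_countable (T := T)) (mu : probability (borel T) R).
Variable cK : compact (spt mu).

Definition mm_spt : mmSpace R :=
  @MMSpace R (metric_sub cK (spt_neq0 mu T2)) (prob_sub (measure_spt mu T2))
    (metric_sub_separable cK (spt_neq0 mu T2)).

End mm_of_support.

Definition right_uniform (G : topologicalGroupType) : Type := G.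

Section right_uniformity.
Local Open Scope relation_scope.
Variable G : topologicalGroupType.
Local Notation rG := (right_uniform G).

HB.instance Definition _ := Topological.copy rG G.

Definition right_ent : set_system (rG * rG) :=
  filter_from (nbhs (1%g : G))
    (fun U => [set xy : G * G | U (xy.2 * xy.1^-1)%g]).

Lemma rtrans_continuous (g : G) : continuous (fun x : G => x * g)%g.
Proof.
move=> x; apply: (@continuous_comp _ _ _ (fun y : G => (y, g))
  (fun z : G * G => (z.1 * z.2)%g)); last exact: mulg_continuous.
by apply: cvg_pair => /=; [exact: cvg_id|exact: cvg_cst].
Qed.

Let right_ent_filter : Filter right_ent.
Proof.
apply: filter_from_filter; first by exists setT; exact: filterT.
by move=> U V nU nV; exists (U `&` V); [exact: filterI|move=> xy []].
Qed.

Let right_ent_refl A : right_ent A -> diagonal `<=` A.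
Proof.
move=> [U nU UA] [x y] /diagonalP ->; apply: UA => /=.
by rewrite mulgV; exact: nbhs_singleton nU.
Qed.

Let right_ent_inv A : right_ent A -> right_ent A^-1.
Proof.
move=> [U nU UA]; exists [set x : G | U (x^-1)%g].
  by apply: (invg_continuous (1%g : G)); rewrite invg1.
by move=> [x y] /= Uxy; apply: UA => /=; move: Uxy; rewrite invgM invgK.
Qed.

Let right_ent_split A :
  right_ent A -> exists2 B, right_ent B & B \; B `<=` A.
Proof.
move=> [U nU UA].
have : nbhs ((1%g, 1%g) : G * G) [set z | U (z.1 * z.2)%g].
  by apply: (mulg_continuous ((1%g, 1%g) : G * G)); rewrite /= mulg1.
move=> [[V W] /= [nV nW] VWU].
exists [set xy : G * G | (V `&` W) (xy.2 * xy.1^-1)%g].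
  by exists (V `&` W) => //; exact: filterI.
move=> [x z] [y /= [_ Wyx] [Vzy _]]; apply: UA => /=.
rewrite (_ : z * x^-1 = (z * y^-1) * (y * x^-1))%g; last first.
  by rewrite mulgA mulgVK.
exact: (VWU (_, _)).
Qed.

Let right_ent_nbhs : nbhs = nbhs_ right_ent.
Proof.
rewrite predeq2E => x A; split.
  move=> nA; exists [set xy : G * G | A (xy.2 * xy.1^-1 * x)%g].
    exists [set u : G | A (u * x)%g] => //.
    have := @rtrans_continuous x (1%g : G).
    by rewrite /continuous_at mul1g => /(_ A nA).
  by move=> y /xsectionP/=; rewrite mulgVK.
move=> [E [U nU UE] EA].
apply: (@filterS _ _ _ [set y : G | U (y * x^-1)%g]).
  by move=> y Uyx; apply/EA/xsectionP; exact: UE.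
have := @rtrans_continuous (x^-1)%g (x : G).
by rewrite /continuous_at mulgV => /(_ U nU).
Qed.

HB.instance Definition _ := @Nbhs_isUniform.Build rG
  right_ent right_ent_filter right_ent_refl right_ent_inv
  right_ent_split right_ent_nbhs.

End right_uniformity.

Section RUCB.
Variables (R : realType) (G : topologicalGroupType).

Definition rucb : {pred G -> R} := mem
  [set f : G -> R | bounded_fun f /\ unif_continuous (f : right_uniform G -> R)].

Record RUCB := MkRUCB { rucb_val :> G -> R ; rucb_valP : rucb_val \in rucb }.

HB.instance Definition _ := [isSub for rucb_val].
HB.instance Definition _ := [Choice of RUCB by <:].

Lemma rucbP f : f \in rucb <-> (exists M, forall x, `|f x| <= M) /\
  forall e, 0 < e -> exists2 U, nbhs (1%g : G) U &
    forall x y, U (y * x^-1)%g -> `|f x - f y| < e.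
Proof.
have PF := @globally_properfilter G [set: G] 1%g Logic.I.
rewrite inE; split => -[bf uf]; split.
- have [M fM] := (@ex_bound _ _ _ f _ PF).1 bf.
  by exists M => x; exact: fM.
- move=> e e0.
  have [U nU Uf] := uf _ (entourage_ball R (PosNum e0)).
  by exists U => // x y Uyx; exact: (Uf (x, y)).
- by have [M fM] := bf; apply/(@ex_bound _ _ _ f _ PF); exists M => x _; exact: fM.
- move=> A /=; rewrite -entourage_ballE => -[e /= e0 eA].
  have [U nU Uf] := uf _ e0.
  by exists U => // -[x y] /= Uyx; apply: eA; exact: Uf.
Qed.

Lemma rucb_subring_closed : subring_closed rucb.
Proof.
split=> [|f g /rucbP[[M fM] uf] /rucbP[[N gN] ug]|f g /rucbP[[M fM] uf] /rucbP[[N gN] ug]];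
  apply/rucbP; split.
- by exists 1 => x; rewrite normr1.
- move=> e e0; exists setT; first exact: filterT.
  by move=> x y _; rewrite subrr normr0.
- by exists (M + N) => x; rewrite (le_trans (ler_normB _ _))// lerD.
- move=> e e0; have e20 : 0 < e / 2 by rewrite divr_gt0.
  have [U nU Uf] := uf _ e20; have [V nV Vg] := ug _ e20.
  exists (U `&` V); first exact: filterI.
  move=> x y [/Uf fxy /Vg gxy]; rewrite [e]splitr.
  rewrite (_ : _ - _ = (f x - f y) - (g x - g y)).
    by rewrite (le_lt_trans (ler_normB _ _))// ltrD.
  change (f x - g x - (f y - g y) = f x - f y - (g x - g y)).
  by rewrite !opprB [g y - f y]addrC addrACA [- g x + _]addrC.
- by exists (M * N) => x; rewrite normrM ler_pM.
- move=> e e0; set K := `|M| + `|N| + 1.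
  have K0 : 0 < K by rewrite ltr_wpDl// addr_ge0.
  have eK0 : 0 < e / K by rewrite divr_gt0.
  have [U nU Uf] := uf _ eK0; have [V nV Vg] := ug _ eK0.
  exists (U `&` V); first exact: filterI.
  move=> x y [/Uf fxy /Vg gxy].
  rewrite (_ : _ - _ = f x * (g x - g y) + (f x - f y) * g y); last first.
    by rewrite mulrBr mulrBl addrA subrK.
  rewrite (le_lt_trans (ler_normD _ _))// !normrM.
  rewrite (@le_lt_trans _ _ (`|M| * (e / K) + (e / K) * `|N|))//.
    rewrite lerD// ler_pM// ?(ltW fxy) ?(ltW gxy)//.
      exact: le_trans (fM x) (ler_norm _).
    exact: le_trans (gN y) (ler_norm _).
  rewrite [_ * `|N|]mulrC -mulrDl mulrCA -ltr_pdivlMl// mulVf ?gt_eqF//.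
  by rewrite ltr_pdivrMr// mul1r ltrDl.
Qed.
HB.instance Definition _ := GRing.isSubringClosed.Build _
  rucb rucb_subring_closed.
HB.instance Definition _ := GRing.SubChoice_isSubComPzRing.Build _ rucb RUCB
  rucb_subring_closed.


Lemma rucb_ltrans_subproof (g : G) (f : RUCB) :
  (fun x => f (g * x)%g) \in rucb.
Proof.
have /rucbP[[M fM] uf] := rucb_valP f; apply/rucbP; split; first by exists M.
move=> e /uf[U nU Uf]; exists [set u : G | U (g * (u * g^-1))%g].
  have := @ltrans_continuous G g (g^-1)%g.
  rewrite /continuous_at /ltrans mulgV => /(_ U nU) nU'.
  have := @rtrans_continuous G (g^-1)%g 1%g.
  by rewrite /continuous_at mul1g => /(_ _ nU').
move=> x y Uyx; apply: Uf; rewrite invgM.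
by move: Uyx; rewrite /= !mulgA.
Qed.

Definition rucb_ltrans (g : G) (f : RUCB) : RUCB :=
  MkRUCB (rucb_ltrans_subproof g f).

Let rucb_ltrans_zmod g : zmod_morphism (rucb_ltrans g).
Proof. by move=> f h; apply/val_inj/funext. Qed.
Let rucb_ltrans_monoid g : monoid_morphism (rucb_ltrans g).
Proof. by split => [|f h]; apply/val_inj/funext. Qed.
HB.instance Definition _ g := GRing.isZmodMorphism.Build RUCB RUCB
  (rucb_ltrans g) (rucb_ltrans_zmod g).
HB.instance Definition _ g := GRing.isMonoidMorphism.Build RUCB RUCB
  (rucb_ltrans g) (rucb_ltrans_monoid g).

Definition rucb_eval (x : G) (f : RUCB) : R := f x.

Let rucb_eval_zmod x : zmod_morphism (rucb_eval x). Proof. by []. Qed.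
Let rucb_eval_monoid x : monoid_morphism (rucb_eval x). Proof. by []. Qed.
HB.instance Definition _ x := GRing.isZmodMorphism.Build RUCB R
  (rucb_eval x) (rucb_eval_zmod x).
HB.instance Definition _ x := GRing.isMonoidMorphism.Build RUCB R
  (rucb_eval x) (rucb_eval_monoid x).

End RUCB.

Definition samuel (R : realType) (G : topologicalGroupType) : Type :=
  {rmorphism RUCB R G -> R}.

Section samuel.
Variables (R : realType) (G : topologicalGroupType).
Local Notation SG := (samuel R G).

HB.instance Definition _ := gen_eqMixin SG.
HB.instance Definition _ := gen_choiceMixin SG.
HB.instance Definition _ := Topological.copy SG (initial_topology
  (fun xi : SG => (xi : RUCB R G -> R) : {ptws RUCB R G -> R})).
HB.instance Definition _ := isPointed.Build SG (rucb_eval 1%g).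

Definition samuel_act (g : G) (xi : SG) : SG := xi \o rucb_ltrans g.

Definition invariant_measure (nu : set (borel SG) -> \bar R) :=
  forall g (B : set (borel SG)), measurable B ->
    pushforward nu (samuel_act g : borel SG -> borel SG) B = nu B.

End samuel.

Definition embedding (X Y : topologicalType) (f : X -> Y) :=
  [/\ injective f, continuous f &
    forall U, open U -> exists2 V, open V & f @` U = range f `&` V].

(* Main.v *)
Require Import Defs.
From HB Require Import structures.
From mathcomp Require Import all_boot all_order all_algebra.
From mathcomp Require Import all_classical all_reals all_analysis.
From mathcomp Require Import finmap measurable_realfun ring lra.

(* Couple [K_n] and [X] through parametrizations [phi_n], [psi_n] on [0, 1) along
   which 1-Lipschitz functions correspond up to an error tending to 0 in measure,
   and fix a nonprincipal ultrafilter [U]. Say that [f] on [G] tracks [h] on [X]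
   if [f o phi_n - h o psi_n] tends to 0 in measure along [U]. As [psi_n] has
   law [mu_X] and [mu_X] has full support, [f] tracks at most one continuous
   [h =: T f]; every right uniformly continuous bounded [f] tracks one, by
   ultralimits of Lipschitz functions, so [T] is a ring homomorphism and each
   point [x] of [X] gives a character [f |-> T f x]. By (A), [T] preserves
   means, hence [ker T] is invariant under translation; by compactness [G] then
   permutes these characters, and it preserves [mu_X].

   Injectivity requires that every Lipschitz [h] is tracked by a single [f]. One
   only has a function [f_n] on each [K_n]. Since [d] is right invariant, nothing
   changes if [K_n] is replaced by [K_n r_n]. If [G] is not totally bounded, (A)
   implies that the [r_n] can be chosen such that the sets [K_n r_n] are uniformly
   separated, so that the [f_n] glue to one Lipschitz function on [G]; if [G] is
   totally bounded, the [f_n] have a uniform ultralimit. *)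

Set Implicit Arguments.
Unset Strict Implicit.
Unset Printing Implicit Defensive.

Import Order.TTheory GRing.Theory Num.Theory.
Import numFieldNormedType.Exports.

Local Open Scope classical_set_scope.
Local Open Scope ring_scope.

(** * Lipschitz functions: truncation, extension, approximation from below *)

Section lipschitz_functions.
Context {R : realType}.

Definition lipschitz_with (T : metricType R) (L : R) (f : T -> R) :=
  forall x y, `|f x - f y| <= L * mdist x y.

Lemma lip1_lipschitz (T : metricType R) (f : T -> R) :
  lip1 T f <-> lipschitz_with 1 f.
Proof. by split => lf x y; move: (lf x y); rewrite mul1r. Qed.

Lemma lipschitz_withW (T : metricType R) (L L' : R) (f : T -> R) : L <= L' ->
  lipschitz_with L f -> lipschitz_with L' f.
Proof.
by move=> LL' lf x y; rewrite (le_trans (lf x y))// ler_wpM2r ?mdist_ge0.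
Qed.

Lemma lipschitz_scale (T : metricType R) (L c : R) (f : T -> R) :
  lipschitz_with L f -> lipschitz_with (`|c| * L) (fun x => c * f x).
Proof. by move=> lf x y; rewrite -mulrBr normrM -mulrA ler_wpM2l. Qed.

Lemma continuous_metricP (T : metricType R) (f : T -> R) :
  (forall x e, 0 < e -> exists2 d, 0 < d &
    forall y, mdist x y < d -> `|f x - f y| < e) -> continuous f.
Proof.
move=> cf x; apply/cvgrPdist_lt => e /(cf x)[d d0 xd].
have : nbhs x (ball x d) by exact: nbhsx_ballx.
by apply: filterS => y; rewrite ballEmdist => /xd.
Qed.

Lemma lipschitz_continuous (T : metricType R) (L : R) (f : T -> R) :
  lipschitz_with L f -> continuous f.
Proof.
move=> /(lipschitz_withW (ler_norm L)) lf; apply: continuous_metricP => x e e0.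
exists (e / (`|L| + 1)) => [|y]; first by rewrite divr_gt0// ltr_wpDl.
rewrite ltr_pdivlMr ?ltr_wpDl// mulrC => xy.
apply: le_lt_trans (lf x y) (le_lt_trans _ xy).
by rewrite ler_wpM2r ?mdist_ge0// lerDl.
Qed.

Lemma mdist_lip1 (T : metricType R) (x : T) : lip1 T (mdist x).
Proof.
move=> y z; rewrite ler_norml lerBlDr lerNl opprB lerBlDr.
have := metric_triangle x y z; have := metric_triangle x z y.
by rewrite addrC (metric_sym z y) => -> /=; rewrite addrC => ->.
Qed.

Definition clamp (M a : R) := Num.max (- M) (Num.min M a).

Lemma clamp_bound M a : 0 <= M -> `|clamp M a| <= M.
Proof.
move=> M0; rewrite /clamp ler_norml le_max lexx /= ge_max ge_min lexx andbT.
by rewrite ge0_cp.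
Qed.

Lemma clamp_id M a : `|a| <= M -> clamp M a = a.
Proof. by rewrite /clamp ler_norml => /andP[? ?]; rewrite min_r// max_r. Qed.

Lemma max_dist (a b c : R) : `|Num.max c a - Num.max c b| <= `|a - b|.
Proof.
have key x y : Num.max c x <= Num.max c y + `|x - y|.
  rewrite ge_max; apply/andP; split; first by rewrite ler_wpDr// le_max lexx.
  rewrite -lerBlDr (@le_trans _ _ y)//; last by rewrite le_max lexx orbT.
  by rewrite lerBlDl -lerBlDr ler_norm.
by rewrite ler_norml lerBlDl key andbT lerNl opprB lerBlDl distrC key.
Qed.

Lemma clamp_dist M a b : `|clamp M a - clamp M b| <= `|a - b|.
Proof.
have minE x : Num.min M x = - Num.max (- M) (- x) by rewrite -oppr_min opprK.
apply: (le_trans (max_dist _ _ _)); rewrite !minE -opprD normrN.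
by apply: (le_trans (max_dist _ _ _)); rewrite -opprD normrN.
Qed.

Section mcshane.
Context {T : metricType R}.
Variables (L : R) (S : set T) (F : T -> R).

(** The McShane inf-convolution: for [S] nonempty, [F] bounded on [S] and [L >= 0], it is the
    greatest [L]-Lipschitz function below [F] on [S]. A proper subset [S] gives extensions;
    [S = setT] gives Lipschitz regularizations from below. *)
Definition mcshane (x : T) : R := inf [set F y + L * mdist x y | y in S].

Variable M : R.
Hypotheses (L0 : 0 <= L) (S0 : S !=set0) (FM : forall y, S y -> `|F y| <= M).

Let mcshane_has_lbound x :
  has_lbound [set F y + L * mdist x y | y in S].
Proof.
exists (- M) => _ [y Sy <-]; have /ler_normlP[FN _] := FM Sy.
by rewrite ler_wpDr ?mulr_ge0 ?mdist_ge0// lerNl.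
Qed.

Lemma mcshane_le x y : S y -> mcshane x <= F y + L * mdist x y.
Proof. by move=> Sy; apply: ge_inf => //; exists y. Qed.

Lemma mcshane_ge x c : (forall y, S y -> c <= F y + L * mdist x y) ->
  c <= mcshane x.
Proof.
move=> cF; apply: lb_le_inf => [|_ [y Sy <-]]; last exact: cF.
by case: S0 => y Sy; exists (F y + L * mdist x y), y.
Qed.

Lemma mcshane_lipschitz : lipschitz_with L mcshane.
Proof.
have key x y : mcshane x <= mcshane y + L * mdist x y.
  rewrite -lerBlDr; apply: mcshane_ge => z Sz; rewrite lerBlDr -addrA -mulrDr.
  apply: le_trans (mcshane_le x Sz) _; rewrite lerD2l ler_wpM2l//.
  by rewrite addrC metric_triangle.
move=> x y; rewrite ler_norml lerBlDl key andbT lerNl opprB lerBlDl.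
by rewrite metric_sym key.
Qed.

Lemma mcshane_eq x :
  S x -> (forall y, S y -> `|F x - F y| <= L * mdist x y) -> mcshane x = F x.
Proof.
move=> Sx lF; apply/eqP; rewrite eq_le; apply/andP; split.
  by apply: le_trans (mcshane_le x Sx) _; rewrite mdistxx mulr0 addr0.
apply: mcshane_ge => y /lF; rewrite ler_norml => /andP[_].
by rewrite lerBlDl addrC.
Qed.

End mcshane.

Lemma lipschitz_clamp (T : metricType R) (L M : R) (f : T -> R) :
  lipschitz_with L f -> lipschitz_with L (fun x => clamp M (f x)).
Proof. by move=> lf x y; apply: le_trans (clamp_dist _ _ _) (lf x y). Qed.

Lemma lipschitz_extension (T : metricType R) (L M : R) (S : set T)
    (F : T -> R) : 0 <= L -> 0 <= M -> (forall x, S x -> `|F x| <= M) ->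
  (forall x y, S x -> S y -> `|F x - F y| <= L * mdist x y) ->
  exists f : T -> R, [/\ lipschitz_with L f, forall x, `|f x| <= M &
    forall x, S x -> f x = F x].
Proof.
move=> L0 M0 FM lF; have [S0|/set0P S0] := eqVneq S set0.
  by exists (fun=> 0); split => [x y|x|x]; rewrite ?S0// ?subrr normr0//
    mulr_ge0// mdist_ge0.
(* The McShane extension is bounded below but perhaps not above; truncation restores the bound and
   leaves the values on [S] alone. *)
exists (fun x => clamp M (mcshane L S F x)); split.
- by apply: lipschitz_clamp; apply: mcshane_lipschitz FM.
- by move=> x; exact: clamp_bound.
- move=> x Sx; rewrite (@mcshane_eq _ _ _ _ M)// ?clamp_id// ?FM//.
  by move=> y Sy; exact: lF.
Qed.

(** The McShane regularization with slope [2 * M / d]: points at distance at least [d] cannot push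
    the infimum below [f x], since the penalty there is at least [2 * M], and nearer points lower it
    by at most [e]. *)
Lemma lipschitz_approximation (T : metricType R) (f : T -> R) (M d e : R) :
  0 < d -> 0 <= e ->
  (forall x, `|f x| <= M) -> (forall x y, mdist x y < d -> `|f x - f y| <= e) ->
  exists (L : R) (f' : T -> R), [/\ 0 <= L, lipschitz_with L f',
    forall x, f' x <= f x & forall x, f x <= f' x + e].
Proof.
move=> d0 e0 fM fd; have [t|noT] := pselect (exists t : T, True); last first.
  by exists 0, f; split => // [x y|x]; case: noT; exists x.
have [t0 _] := t.
have M0 : 0 <= M := le_trans (normr_ge0 _) (fM t0).
have L0 : 0 <= 2 * M / d by rewrite divr_ge0 ?mulr_ge0// ltW.
have T0 : [set: T] !=set0 by exists t0.
have fM' y : [set: T] y -> `|f y| <= M by [].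
exists (2 * M / d), (mcshane (2 * M / d) setT f); split => //.
- exact: mcshane_lipschitz fM'.
- move=> x; apply: le_trans (mcshane_le L0 fM' x (I : setT x)) _.
  by rewrite mdistxx mulr0 addr0.
- move=> x; rewrite -lerBlDr; apply: mcshane_ge => // y _.
  have [/fd|dxy] := ltP (mdist x y) d.
    rewrite ler_norml => /andP[_ fxy]; rewrite lerBlDr -addrA.
    rewrite -lerBlDl (le_trans fxy)// lerDr mulr_ge0 ?mdist_ge0//.
  have : 2 * M <= 2 * M / d * mdist x y.
    by rewrite -[leLHS](divfK (lt0r_neq0 d0)) ler_wpM2l.
  have := fM x; have := fM y; rewrite !ler_norml => /andP[? ?] /andP[? ?]; lra.
Qed.

End lipschitz_functions.

(** * Total boundedness and ultralimits *)

Section total_boundedness.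
Context {R : realType}.

Definition totally_bounded (T : metricType R) (A : set T) :=
  forall e : R, 0 < e -> exists s : seq T,
    forall x, A x -> exists2 y, y \in s & mdist x y < e.

Lemma metric_ball_open (T : metricType R) (x : T) (e : R) : open (ball x e).
Proof.
rewrite openE => y; rewrite ballEmdist/= => xy.
apply: (@filterS _ _ _ (ball y (e - mdist x y))); last first.
  by apply: nbhsx_ballx; rewrite subr_gt0.
move=> z; rewrite !ballEmdist/= ltrBrDl; apply: le_lt_trans.
exact: metric_triangle.
Qed.

Lemma compact_totally_bounded (T : pmetricType R) (A : set T) :
  compact A -> totally_bounded A.
Proof.
rewrite compact_cover => cA e e0.
have [x _|x Ax|s _ sA] := cA T setT (fun x => (ball x e)).
- exact: metric_ball_open.
- by exists x => //; exact: ballxx.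
exists (enum_fset s) => x /sA[y /= ys]; rewrite ballEmdist/= => yx.
by exists y => //; rewrite metric_sym.
Qed.

Lemma filter_forall_seq (I : choiceType) (V : set_system nat) (FV : Filter V)
    (s : seq I) (Q : I -> nat -> Prop) :
  (forall i, \forall k \near V, Q i k) ->
  \forall k \near V, forall i, i \in s -> Q i k.
Proof.
move=> VQ; elim: s => [|i s IH]; first by apply: filterS filterT => k.
apply: filterS2 (VQ i) IH => k Qi Qs j.
by rewrite inE => /predU1P[->//|]; exact: Qs.
Qed.

Variables (U : set_system nat) (UU : UltraFilter U).

(** The limit is the supremum of the set [A] of lower bounds of [u] along [U]. The ultrafilter
    decides whether [sup A + e] is such a bound, and it cannot be, as it would then belong to
    [A]. *)
Lemma ultralimit (M : R) (u : nat -> R) : (forall k, `|u k| <= M) ->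
  exists2 l, `|l| <= M & forall e : R, 0 < e -> \forall k \near U, `|u k - l| <= e.
Proof.
move=> uM; pose A := [set a : R | \forall k \near U, a <= u k].
have AM a : A a -> a <= M.
  by move=> /filter_ex[k au]; have := uM k; rewrite ler_norml => /andP[_];
    exact: le_trans.
have AN : A (- M).
  by apply: filterS filterT => k _; have := uM k; rewrite ler_norml => /andP[].
have supA : has_sup A by split; [exists (- M)|exists M => a /AM].
exists (sup A).
  rewrite ler_norml; apply/andP; split; first exact: ub_le_sup supA.2 _ AN.
  by apply: ge_sup => [|a /AM]//; exists (- M).
move=> e e0; have [a Aa ea] := sup_adherent e0 supA.
have [lU|lU] := in_ultra_setVsetC [set k | sup A + e <= u k] UU.
  by have := ub_le_sup supA.2 lU; rewrite gerDl leNgt e0.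
apply: filterS2 Aa lU => k au /negP; rewrite -ltNge => ul.
by rewrite ler_norml; apply/andP; split; lra.
Qed.

(** Boundedness gives pointwise ultralimits; the common Lipschitz constant and a finite net make the
    convergence uniform. *)
Lemma lipschitz_ultralimit (T : metricType R) (L M : R) (f : nat -> T -> R) :
  totally_bounded [set: T] -> 0 <= L ->
  (forall k, lipschitz_with L (f k)) -> (forall k x, `|f k x| <= M) ->
  exists g : T -> R, [/\ lipschitz_with L g, forall x, `|g x| <= M &
    forall e, 0 < e -> \forall k \near U, forall x, `|f k x - g x| <= e].
Proof.
move=> tbT L0 fL fM.
have /choice[g gP] x : exists l, `|l| <= M /\
    forall e : R, 0 < e -> \forall k \near U, `|f k x - l| <= e.
  by have [l lM fl] := ultralimit (fun k => fM k x); exists l.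
have gL : lipschitz_with L g.
  move=> x y; apply/ler_addgt0Pr => e e0.
  have e20 : 0 < e / 2 by rewrite divr_gt0.
  have [k [kx ky]] := filter_ex (filterI ((gP x).2 _ e20) ((gP y).2 _ e20)).
  have := fL k x y; move: kx ky; rewrite !ler_norml.
  move=> /andP[? ?] /andP[? ?] /andP[? ?]; apply/andP; split; lra.
exists g; split => // [x|e e0]; first exact: (gP x).1.
(* The net has mesh [r / 2], so that passing to a net point costs at most [e / 4] for each of [f k]
   and [g], with another [e / 4] at the net point itself. *)
pose r := e / (2 * (L + 1)).
have L1 : 0 < L + 1 by rewrite ltr_wpDl.
have r0 : 0 < r by rewrite divr_gt0// mulr_gt0.
have Lr : L * r <= e / 2.
  have : r * (L + 1) = e / 2 by rewrite /r; field; rewrite gt_eqF.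
  by move: r0; lra.
have [s sT] := tbT (r / 2) (divr_gt0 r0 (ltr0n _ 2)).
have e20 : 0 < e / 4 by rewrite divr_gt0.
have : \forall k \near U, forall x, x \in s -> `|f k x - g x| <= e / 4.
  by apply: filter_forall_seq => x; exact: (gP x).2.
apply: filterS => k fk x; have [y ys xy] := sT x I.
have Lxy : L * mdist x y <= e / 4.
  apply: (@le_trans _ _ (L * (r / 2))); first by rewrite ler_wpM2l// ltW.
  lra.
have := fk y ys; have := fL k x y; have := gL x y; move: Lxy; rewrite !ler_norml.
move=> ? /andP[? ?] /andP[? ?] /andP[? ?]; apply/andP; split; lra.
Qed.

End total_boundedness.

(** * Tracking: functions on the group that converge in measure to functions on the limit space *)

Section tracking.
Context {R : realType} {G : pmetricType R} {X : mmSpace R}.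
Context {d} {Om : measurableType d} (P : probability Om R).
Variables (Phi : nat -> Om -> G) (Psi : nat -> Om -> X).

(** Closeness in measure is stated with a measurable exceptional set, because [f] and [h] are
    arbitrary functions and the set where they differ by more than [e] may fail to be measurable. *)
Definition close (k : nat) (e : R) (f : G -> R) (h : X -> R) :=
  exists N : set Om, [/\ measurable N, (P N <= e%:E)%E &
    forall w, ~ N w -> `|f (Phi k w) - h (Psi k w)| <= e].

Lemma closeW k (e e' : R) f h : e <= e' -> close k e f h -> close k e' f h.
Proof.
move=> ee' [N [mN PN fh]]; exists N; split => //.
  by rewrite (le_trans PN)// lee_fin.
by move=> w /fh /le_trans; exact.
Qed.

Lemma close2 k (e e' : R) (f f' F : G -> R) (h h' H : X -> R) : 0 <= e ->
  close k e f h -> close k e f' h' -> 2 * e <= e' ->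
  (forall x y, `|f x - h y| <= e -> `|f' x - h' y| <= e ->
    `|F x - H y| <= e') -> close k e' F H.
Proof.
move=> e0 [N [mN PN fh]] [N' [mN' PN' fh']] ee' FH.
exists (N `|` N'); split; first exact: measurableU.
  rewrite (le_trans (measureU2 _ _ _))// (le_trans (leeD PN PN'))//.
  by rewrite -EFinD lee_fin -mulr2n -mulr_natl.
by move=> w /not_orP[/fh ? /fh' ?]; exact: FH.
Qed.

Variables (U : set_system nat) (UU : UltraFilter U).

Definition tracks (f : G -> R) (h : X -> R) :=
  forall e : R, 0 < e -> \forall k \near U, close k e f h.

Lemma tracks_cst c : tracks (fun=> c) (fun=> c).
Proof.
move=> e e0; apply: filterS filterT => k _; exists set0; split => //.
  by rewrite measure0 lee_fin ltW.
by move=> w _; rewrite subrr normr0 ltW.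
Qed.

Lemma tracks2 (C : R) (f f' F : G -> R) (h h' H : X -> R) :
  tracks f h -> tracks f' h' ->
  (forall x y, `|F x - H y| <= C * (`|f x - h y| + `|f' x - h' y|)) ->
  tracks F H.
Proof.
(* As [c >= 1], both losses stay within [e]: the exceptional sets cost [2 * e'] and the values cost
   [C * (e' + e')]. *)
move=> fh fh' FH e e0; pose c := `|C| + 1.
have c1 : 1 <= c by rewrite lerDr.
have c0 : 0 < c by rewrite (lt_le_trans _ c1).
pose e' := e / (2 * c).
have e'0 : 0 < e' by rewrite divr_gt0// mulr_gt0.
have e'E : c * (e' + e') = e by rewrite /e'; field; rewrite gt_eqF.
apply: filterS2 (fh _ e'0) (fh' _ e'0) => k fk fk'.
apply: (close2 (ltW e'0) fk fk').
- by rewrite -e'E mulr_natl mulr2n ler_peMl// addr_ge0 ?ltW.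
- move=> x y ? ?; rewrite (le_trans (FH x y))// -e'E.
  rewrite (@le_trans _ _ (c * (`|f x - h y| + `|f' x - h' y|)))//.
    by rewrite ler_wpM2r ?addr_ge0// (le_trans (ler_norm _))// lerDl.
  by rewrite ler_wpM2l ?lerD// ltW.
Qed.

Lemma tracksB f f' h h' : tracks f h -> tracks f' h' ->
  tracks (fun x => f x - f' x) (fun y => h y - h' y).
Proof.
move=> fh fh'; apply: (tracks2 (C := 1) fh fh') => x y; rewrite mul1r.
rewrite (_ : _ - _ = (f x - h y) - (f' x - h' y)); last by ring.
exact: ler_normB.
Qed.

Lemma tracksZ c f h : tracks f h ->
  tracks (fun x => c * f x) (fun y => c * h y).
Proof.
move=> fh; apply: (tracks2 (C := `|c|) fh fh) => x y.
by rewrite -mulrBr normrM ler_wpM2l// lerDl.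
Qed.

Lemma tracks_max c f h : tracks f h ->
  tracks (fun x => Num.max c (f x)) (fun y => Num.max c (h y)).
Proof.
move=> fh; apply: (tracks2 (C := 1) fh fh) => x y.
by rewrite mul1r (le_trans (max_dist _ _ _))// lerDl.
Qed.

Lemma tracksM (M : R) f f' h h' : (forall x, `|f x| <= M) ->
  (forall y, `|h' y| <= M) -> tracks f h -> tracks f' h' ->
  tracks (fun x => f x * f' x) (fun y => h y * h' y).
Proof.
move=> fM hM fh fh'; apply: (tracks2 (C := M) fh fh') => x y.
rewrite (_ : _ - _ = (f x - h y) * h' y + f x * (f' x - h' y)); last by ring.
rewrite (le_trans (ler_normD _ _))// !normrM mulrDr.
by rewrite lerD// ?ler_wpM2r// mulrC ler_wpM2r.
Qed.

Hypothesis mPsi : forall k, measurable_fun [set: Om] (Psi k : Om -> borel X).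
Hypothesis PPsi : forall k (B : set (borel X)), measurable B ->
  P (Psi k @^-1` B) = mm_measure X B.
Hypothesis Xfull : fully_supported X.

(** A failure at one point would be a failure with a margin on an open set [W], which has positive
    measure by full support. Its preimage under [Psi k] has the same measure, too much for the
    exceptional sets to cover, and a point outside them contradicts the inequality on the group. *)
Lemma tracks_le (c : R) f f' h h' : continuous h -> continuous h' ->
  tracks f h -> tracks f' h' -> (forall x, f x <= f' x + c) ->
  forall x, h x <= h' x + c.
Proof.
move=> ch ch' fh fh' ff' x; rewrite leNgt; apply/negP => hx.
(* The gap is [3 * e] at [x] and more than [2 * e] on [W], which two tracking errors of size at most
   [e] cannot absorb. *)
pose e := (h x - h' x - c) / 3.
have e0 : 0 < e by rewrite divr_gt0// subr_gt0 ltrBrDl.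
pose W : set X := [set y | 2 * e < h y - h' y - c].
have oW : open W.
  have cw : continuous (fun y => h y - h' y - c).
    by move=> y; apply: cvgB; [apply: cvgB; [exact: ch|exact: ch']|exact: cvg_cst].
  have -> : W = (fun y => h y - h' y - c) @^-1` `]2 * e, +oo[.
    by apply/seteqP; split => y /=; rewrite /W/= in_itv/= andbT.
  by move/continuousP: cw; apply; exact: interval_open.
have mW : measurable (W : set (borel X)) by exact: open_borel.
have : spt (mm_measure X) x by rewrite Xfull.
move=> /(_ W) /(_ _)/wrap[].
  by split => //; rewrite /W /= /e; move: hx; lra.
set m := mm_measure X W => m0.
have mfin : m \is a fin_num by exact: fin_num_measure.
(* With the bound [m / 3], two exceptional sets have less mass than the preimage of [W]. *)
pose e' := Num.min e (fine m / 3).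
have fm0 : 0 < fine m by rewrite fine_gt0// m0 -ge0_fin_numE// measure_ge0.
have e'0 : 0 < e' by rewrite lt_min e0 divr_gt0.
have [k [[N [mN PN fhN]] [N' [mN' PN' fhN']]]] :=
  filter_ex (filterI (fh _ e'0) (fh' _ e'0)).
have mWk : measurable (Psi k @^-1` W).
  by rewrite -[X in measurable X]setTI; exact: mPsi.
have [sub|] := pselect (Psi k @^-1` W `<=` N `|` N').
  have : (m <= (e' + e')%:E)%E.
    rewrite /m -(PPsi k mW) (@le_trans _ _ (P (N `|` N')))//.
      exact: le_measure (mem_set mWk) (mem_set (measurableU _ _ mN mN')) sub.
    by rewrite (le_trans (measureU2 _ _ _))// EFinD leeD.
  rewrite -(fineK mfin) lee_fin.
  have : e' <= fine m / 3 by rewrite ge_min lexx orbT.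
  by move: fm0; lra.
move=> /existsNP[w /not_implyP[Ww /not_orP[/fhN + /fhN' +]]].
have := ff' (Phi k w); move: Ww; rewrite /W /=.
have : e' <= e by rewrite ge_min lexx.
by rewrite !ler_norml => ? ? ? /andP[? ?] /andP[? ?]; lra.
Qed.

Lemma tracks_unique f h h' : continuous h -> continuous h' ->
  tracks f h -> tracks f h' -> h = h'.
Proof.
move=> ch ch' fh fh'; apply/funext => x; apply/eqP; rewrite eq_le.
have ff y : f y <= f y + 0 by rewrite addr0.
have := tracks_le ch ch' fh fh' ff x; have := tracks_le ch' ch fh' fh ff x.
by rewrite !addr0 => -> ->.
Qed.

Hypothesis Xcompact : mm_compact X.
Hypothesis Uoo : \oo `<=` U.
Hypothesis conc : forall k (f : G -> R), lip1 G f ->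
  exists2 h : X -> R, lip1 X h & close k k.+1%:R^-1 f h.

Lemma near_invS (e : R) : 0 < e -> \forall k \near U, k.+1%:R^-1 <= e.
Proof.
move=> e0; apply: Uoo.
have := @near_infty_natSinv_lt R (PosNum e0); apply: filterS => k /= /ltW.
exact.
Qed.

(** The partners [h k] given by concentration depend on [k]. Truncated at [M], which costs nothing
    because [f] is bounded by [M], they have a uniform ultralimit on the compact space [X]. *)
Lemma lip1_tracks (M : R) (f : G -> R) : lip1 G f ->
  (forall x, `|f x| <= M) -> exists2 h : X -> R, lip1 X h & tracks f h.
Proof.
move=> lf fM; have M0 : 0 <= M := le_trans (normr_ge0 _) (fM point).
have /choice[h hP] k : exists h : X -> R, lip1 X h /\ close k k.+1%:R^-1 f h.
  by have [h lh fh] := conc k lf; exists h.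
have [||||g [gL _ hg]] :=
  @lipschitz_ultralimit _ _ UU X 1 M (fun k y => clamp M (h k y)).
- exact: compact_totally_bounded.
- by [].
- by move=> k; apply: lipschitz_clamp; apply/lip1_lipschitz; exact: (hP k).1.
- by move=> k x; exact: clamp_bound.
exists g; first exact/lip1_lipschitz.
move=> e e0; have e20 : 0 < e / 2 by rewrite divr_gt0.
apply: filterS2 (near_invS e20) (hg _ e20) => k ke hgk.
have := closeW ke (hP k).2 => -[N [mN PN fh]]; exists N; split => //.
  by rewrite (le_trans PN)// lee_fin ler_pdivrMr// ler_peMr ?ler1n// ltW.
move=> w /fh fhw; have := hgk (Psi k w); have := le_trans (clamp_dist M _ _) fhw.
rewrite (clamp_id (fM (Phi k w))) !ler_norml => /andP[? ?] /andP[? ?].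
by apply/andP; split; lra.
Qed.

Lemma lipschitz_tracks (L M : R) (f : G -> R) : lipschitz_with L f ->
  (forall x, `|f x| <= M) -> exists2 h : X -> R, continuous h & tracks f h.
Proof.
move=> lf fM; pose c := `|L| + 1; have c0 : 0 < c by rewrite ltr_wpDl.
have lf1 : lip1 G (fun x => c^-1 * f x).
  apply/lip1_lipschitz; apply: lipschitz_withW (lipschitz_scale c^-1 lf).
  rewrite ger0_norm ?invr_ge0 ?(ltW c0)// ler_pdivrMl// mulr1.
  by rewrite (le_trans (ler_norm _))// lerDl.
have [x|h lh fh] := @lip1_tracks (`|c^-1| * M) _ lf1.
  by rewrite normrM ler_wpM2l.
exists (fun y => c * h y).
  by apply: lipschitz_continuous (lipschitz_scale c _); exact/lip1_lipschitz.
have := tracksZ c fh; congr (tracks _ _); apply/funext => x.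
by rewrite mulVKf// gt_eqF.
Qed.

(** [h] is the supremum of the continuous functions tracked by minorants of [f]. There are Lipschitz
    minorants within any [e] of [f], and [tracks_le] puts [h] within [e] of the functions that these
    track; continuity and tracking pass to [h]. *)
Lemma tracks_exists (M : R) (f : G -> R) : (forall x, `|f x| <= M) ->
  (forall e : R, 0 < e -> exists2 r : R, 0 < r &
    forall x y, mdist x y < r -> `|f x - f y| <= e) ->
  exists2 h : X -> R, continuous h & tracks f h.
Proof.
move=> fM uf.
pose low (p : (G -> R) * (X -> R)) :=
  [/\ continuous p.2, tracks p.1 p.2 & forall x, p.1 x <= f x].
have lowP e : 0 < e -> exists2 p, low p & forall x, f x <= p.1 x + e.
  move=> e0; have [r r0 fr] := uf e e0.
  have [L [f' [L0 lf' f'f ff']]] := lipschitz_approximation r0 (ltW e0) fM fr.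
  have [|h ch fh] := @lipschitz_tracks L (M + e) f' lf'.
    move=> x; have := f'f x; have := ff' x; have := fM x.
    by rewrite !ler_norml => /andP[? ?] ? ?; apply/andP; split; lra.
  by exists (f', h).
have low_le e p q : 0 < e -> low p -> low q -> (forall x, f x <= p.1 x + e) ->
    forall y, q.2 y <= p.2 y + e.
  move=> e0 [cp tp pf] [cq tq qf] fp; apply: (tracks_le cq cp tq tp) => x.
  exact: le_trans (qf x) (fp x).
pose h y := sup [set p.2 y | p in low].
have hP e p : 0 < e -> low p -> (forall x, f x <= p.1 x + e) ->
    forall y, p.2 y <= h y <= p.2 y + e.
  move=> e0 lp fp y; apply/andP; split.
    apply: ub_le_sup; last by exists p.
    by exists (p.2 y + e) => _ [q lq <-]; exact: low_le.
  apply: ge_sup; first by exists (p.2 y), p.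
  by move=> _ [q lq <-]; exact: low_le.
exists h.
  apply: continuous_metricP => y e e0; have e30 : 0 < e / 4 by rewrite divr_gt0.
  have [p lp fp] := lowP _ e30; have [cp _ _] := lp.
  have /cvgrPdist_lt/(_ _ e30) := cp y.
  rewrite -metricType_numDomainType.filter_from_mdist_nbhs => -[r /= r0 pr].
  exists r => // z /pr /=; have := hP _ _ e30 lp fp y; have := hP _ _ e30 lp fp z.
  move=> /andP[? ?] /andP[? ?]; rewrite !ltr_norml => /andP[? ?].
  by apply/andP; split; lra.
move=> e e0; have e20 : 0 < e / 2 by rewrite divr_gt0.
have [p lp fp] := lowP _ e20; have [_ tp pf] := lp.
apply: filterS (tp _ e20) => k fk; apply: (close2 (ltW e20) fk fk).
  by rewrite mulrC divfK.
move=> x y + _; have := hP _ _ e20 lp fp y; have := fp x; have := pf x.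
by rewrite !ler_norml => ? ? /andP[? ?] /andP[? ?]; apply/andP; split; lra.
Qed.

End tracking.

(** * Integrals of bounded functions against probability measures *)

Section bounded_integrals.
Context {R : realType}.

Lemma continuous_measurable_borel (T : ptopologicalType) (f : T -> R) :
  continuous f -> measurable_fun [set: borel T] (f : borel T -> R).
Proof.
move=> /continuousP cf; apply: (measurability _ (RGenOpens.measurableE R)).
move=> _ [_ [a [b ->] <-]]; rewrite setTI; apply: open_borel; apply: cf.
exact: interval_open.
Qed.

Lemma bounded_integrable d (T : measurableType d) (P : probability T R)
    (f : T -> R) (M : R) : measurable_fun [set: T] f ->
  (forall x, `|f x| <= M) -> P.-integrable setT (EFin \o f).
Proof.
move=> mf fM; apply: measurable_bounded_integrable => //.
  exact: le_lt_trans (probability_le1 P measurableT) (ltry 1).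
by exists M; split; [exact: num_real|move=> r Mr x _; exact: le_trans (fM x) (ltW Mr)].
Qed.

Lemma probability_integrable_cst d (T : measurableType d)
    (P : probability T R) (c : R) : P.-integrable setT (EFin \o (fun=> c)).
Proof. by apply: (@bounded_integrable _ _ P _ `|c|) => // ; exact: measurable_cst. Qed.

Lemma probability_Rintegral_cst d (T : measurableType d)
    (P : probability T R) (c : R) : \int[P]_x c = c.
Proof.
rewrite Rintegral_cst//; have -> : fine (P setT) = 1 by rewrite probability_setT.
by rewrite mulr1.
Qed.

Lemma Rintegral_law d d' (T : measurableType d) (T' : measurableType d')
    (P : probability T R) (Q : probability T' R) (phi : T -> T') (f : T' -> R)
    (M : R) : measurable_fun [set: T] phi ->
  (forall B, measurable B -> P (phi @^-1` B) = Q B) ->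
  measurable_fun [set: T'] f -> (forall x, `|f x| <= M) ->
  \int[Q]_x f x = \int[P]_w f (phi w).
Proof.
move=> mphi PQ mf fM; rewrite /Rintegral; congr fine.
rewrite -(@integral_pushforward _ _ _ _ _ _ mphi P setT (EFin \o f))//.
- by apply: eq_measure_integral => A mA _; exact/esym/PQ.
- exact/measurable_EFinP.
- apply: (@bounded_integrable _ _ _ (f \o phi) M) => [|w].
    exact: measurableT_comp.
  exact: fM.
Qed.

(** Integrates the pointwise bound [c + 2 * M * \1_N] on the distance between [f] and [g]. *)
Lemma Rintegral_dist d (T : measurableType d) (P : probability T R)
    (f g : T -> R) (M c e : R) (N : set T) : measurable N -> 0 <= c -> 0 <= M ->
  measurable_fun [set: T] f -> measurable_fun [set: T] g ->
  (forall x, `|f x| <= M) -> (forall x, `|g x| <= M) ->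
  (P N <= e%:E)%E -> (forall x, ~ N x -> `|f x - g x| <= c) ->
  `|\int[P]_x f x - \int[P]_x g x| <= c + 2 * M * e.
Proof.
move=> mN c0 M0 mf mg fM gM PN fg.
have fi := bounded_integrable P mf fM; have gi := bounded_integrable P mg gM.
have fgM x : `|f x - g x| <= 2 * M.
  by rewrite (le_trans (ler_normB _ _))// mulr_natl mulr2n lerD.
have mfg : measurable_fun [set: T] (fun x => f x - g x) by exact: measurable_funB.
rewrite -RintegralB// (le_trans (le_normr_Rintegral _ _))//.
  exact: bounded_integrable mfg fgM.
have mNi : measurable_fun [set: T] (\1_N : T -> R) by exact: measurable_indic.
have N1 x : `|\1_N x : R| <= 1.
  by rewrite indicE ger0_norm//; case: (_ \in _).
have Ni := bounded_integrable P mNi N1.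
apply: (@le_trans _ _ (\int[P]_x (c + 2 * M * \1_N x))).
  apply: le_Rintegral => //.
  - apply: (@bounded_integrable _ _ _ (fun x => `|f x - g x|) (2 * M)).
      exact: measurableT_comp.
    by move=> x; rewrite normr_id.
  - apply: (@bounded_integrable _ _ _ (fun x => c + 2 * M * \1_N x) (c + 2 * M)).
      by apply: measurable_funD => //; exact: measurable_funM.
    move=> x; rewrite (le_trans (ler_normD _ _))// normrM !ger0_norm ?mulr_ge0//.
    by rewrite lerD2l ler_piMr ?mulr_ge0// (le_trans (ler_norm _)).
  move=> x _; rewrite indicE; have [Nx|/negP Nx] := boolP (x \in N).
    by rewrite mulr1 ler_wpDl.
  by rewrite mulr0 addr0 fg// => ?; apply: Nx; exact: mem_set.
rewrite RintegralD//; last 2 first.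
- exact: (@bounded_integrable _ _ _ (fun=> c) `|c|).
- apply: (@bounded_integrable _ _ _ (fun x => 2 * M * \1_N x) (2 * M)).
    exact: measurable_funM.
  move=> x; rewrite normrM (@ger0_norm _ (2 * M)) ?mulr_ge0//.
  by rewrite ler_piMr ?mulr_ge0// (le_trans (ler_norm _)).
rewrite Rintegral_cst// RintegralZl//.
have -> : fine (P setT) = 1 by rewrite probability_setT.
rewrite mulr1 lerD2l ler_wpM2l ?mulr_ge0//.
rewrite /Rintegral integral_indic// setIT.
by rewrite -lee_fin fineK// fin_num_measure.
Qed.

(** A positive value [h x] would bound the integral below by [h x / 2] times the measure of the open
    set [W], which is positive by full support. *)
Lemma continuous_integral_eq0 (X : ptopologicalType) (P : probability (borel X) R)
    (h : X -> R) (M : R) : spt P = setT -> continuous h ->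
  (forall x, 0 <= h x) -> (forall x, h x <= M) ->
  \int[P]_x h x = 0 -> forall x, h x = 0.
Proof.
move=> Pfull ch h0 hM h_int x; apply/eqP; rewrite eq_le h0 andbT leNgt.
apply/negP => hx.
have mh := continuous_measurable_borel ch.
have hM' y : `|h y| <= M by rewrite ger0_norm.
have hi := bounded_integrable P mh hM'.
pose W : set X := [set y | h x / 2 < h y].
have oW : open W.
  have -> : W = h @^-1` `]h x / 2, +oo[.
    by apply/seteqP; split => y /=; rewrite /W/= in_itv/= andbT.
  by move/continuousP: ch; apply; exact: interval_open.
have mW : measurable (W : set (borel X)) by exact: open_borel.
have PW : (0 < P W)%E.
  have : spt P x by rewrite Pfull.
  by apply; split => //; rewrite /W /= ltr_pdivrMr// ltr_pMr// ltr1n.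
have W1 y : `|\1_W y : R| <= 1 by rewrite indicE ger0_norm//; case: (_ \in _).
have mWi : measurable_fun [set: borel X] (\1_W : X -> R) by exact: measurable_indic.
have hx20 : 0 < h x / 2 by rewrite divr_gt0.
have : \int[P]_y (h x / 2 * \1_W y) <= \int[P]_y h y.
  apply: le_Rintegral => //.
  - apply: (@bounded_integrable _ (borel X) _ (fun y => h x / 2 * \1_W y) (h x / 2)).
      exact: measurable_funM.
    move=> y; rewrite normrM (@ger0_norm _ (h x / 2)) ?(ltW hx20)//.
    by rewrite ler_piMr// ltW.
  - move=> y _; rewrite indicE; case: (boolP (y \in W)) => [|_]; last by rewrite mulr0.
    by move=> /set_mem; rewrite /W/= mulr1 => /ltW.
rewrite RintegralZl//; last exact: bounded_integrable mWi W1.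
rewrite h_int leNgt mulr_gt0// /Rintegral integral_indic// setIT.
by rewrite fine_gt0// PW -ge0_fin_numE// fin_num_measure.
Qed.

End bounded_integrals.

(** * The algebra [RUCB] in terms of a right-invariant metric *)

Section rucb_of_metric.
Context {R : realType} {G : metricGroupType R}.
Hypothesis rinv : right_invariant_metric G.

Lemma mdist_mulV (x y : G) : mdist (1%g : G) (y * x^-1)%g = mdist x y.
Proof. by rewrite -(rinv x y x^-1%g) mulgV. Qed.

(** By right invariance [y * x^-1] is as far from the neutral element as [y] is from [x], so the
    right uniformity is the uniformity of the metric. *)
Lemma rucb_metricP (f : G -> R) : f \in @rucb R G <->
  (exists M, forall x, `|f x| <= M) /\
  forall e : R, 0 < e -> exists2 r : R, 0 < r &
    forall x y, mdist x y < r -> `|f x - f y| <= e.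
Proof.
rewrite rucbP; split => -[fM uf]; split => // e e0.
  have [W nW Wf] := uf e e0; move: nW.
  rewrite -metricType_numDomainType.filter_from_mdist_nbhs => -[r /= r0 rW].
  by exists r => // x y; rewrite -mdist_mulV => /rW/Wf/ltW.
have [r r0 rf] := uf (e / 2) (divr_gt0 e0 (ltr0n _ 2)).
exists (ball (1%g : G) r); first exact: nbhsx_ballx.
move=> x y; rewrite ballEmdist/= mdist_mulV => /rf /le_lt_trans; apply.
by rewrite ltr_pdivrMr// ltr_pMr// ltr1n.
Qed.

Lemma rucb_lipschitz (L M : R) (f : G -> R) : lipschitz_with L f ->
  (forall x, `|f x| <= M) -> f \in @rucb R G.
Proof.
move=> /(lipschitz_withW (ler_norm L)) lf fM; apply/rucb_metricP.
split; first by exists M.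
move=> e e0; exists (e / (`|L| + 1)) => [|x y].
  by rewrite divr_gt0// ltr_wpDl.
rewrite ltr_pdivlMr ?ltr_wpDl// mulrC => /ltW xy.
apply: le_trans (lf x y) (le_trans _ xy).
by rewrite ler_wpM2r ?mdist_ge0// lerDl.
Qed.

Lemma rucb_cst_subproof (c : R) : (fun=> c) \in @rucb R G.
Proof.
apply: (@rucb_lipschitz 0 `|c|) => // x y.
by rewrite subrr normr0 mul0r.
Qed.
Definition rucb_cst (c : R) : RUCB R G := MkRUCB (rucb_cst_subproof c).

Lemma rucb_max_subproof (c : R) (f : RUCB R G) :
  (fun x => Num.max c (f x)) \in @rucb R G.
Proof.
have /rucb_metricP[[M fM] uf] := rucb_valP f; apply/rucb_metricP; split.
  exists (`|c| + M) => x; have M0 := le_trans (normr_ge0 _) (fM x).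
  rewrite /Num.max; case: ifP => _; last by rewrite lerDl.
  by rewrite (le_trans (fM x))// lerDr.
move=> e /uf[r r0 rf]; exists r => // x y /rf.
exact: le_trans (max_dist _ _ _).
Qed.
Definition rucb_max (c : R) (f : RUCB R G) : RUCB R G :=
  MkRUCB (rucb_max_subproof c f).

End rucb_of_metric.

(** * Points and topology of the Samuel compactification *)

Section samuel_points.
Context {R : realType} {G : topologicalGroupType}.

Definition samuel_of (phi : RUCB R G -> R) (phiB : zmod_morphism phi)
  (phiM : monoid_morphism phi) : samuel R G :=
  HB.pack phi (GRing.isZmodMorphism.Build _ _ phi phiB)
    (GRing.isMonoidMorphism.Build _ _ phi phiM).

Lemma samuel_ext (xi zeta : samuel R G) : (forall f, xi f = zeta f) -> xi = zeta.
Proof.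
move=> /funext; case: xi => xi [[xi1] [xi2]]; case: zeta => zeta [[ze1] [ze2]] /= E.
by subst zeta; congr (GRing.RMorphism.Pack (GRing.RMorphism.Class _ _));
  congr (_ _); exact: Prop_irrelevance.
Qed.

Lemma samuel_eval_continuous (f : RUCB R G) :
  continuous (fun xi : samuel R G => xi f).
Proof.
move=> xi; apply: (@continuous_comp (samuel R G) {ptws RUCB R G -> R} R
  (fun zeta => zeta : RUCB R G -> R) (@proj _ (fun=> R) f)).
  exact: initial_continuous.
exact: proj_continuous.
Qed.

Lemma samuel_continuousP (T : topologicalType) (psi : T -> samuel R G) :
  (forall f, continuous (fun x => psi x f)) -> continuous psi.
Proof.
move=> cpsi; apply: continuous_comp_initial => x.
apply/cvg_sup => f A [V [[W oW <-] Wf] WA].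
have nW : nbhs x [set y | W (psi y f)] := cpsi f x W (open_nbhs_nbhs (conj oW Wf)).
suff : nbhs x [set y | A (psi y : RUCB R G -> R)] by [].
by apply: filterS nW => y; exact: WA.
Qed.

End samuel_points.

(** * The map [T] respects order and ring operations, and its means are translation invariant *)

Section representation.
Context {R : realType} {G : metricGroupType R} {X : mmSpace R}.
Hypothesis rinv : right_invariant_metric G.
Context {d} {Om : measurableType d} (P : probability Om R).
Variables (Phi : nat -> Om -> G) (Psi : nat -> Om -> X).
Variables (U : set_system nat) (UU : UltraFilter U).
Hypothesis mPhi : forall k, measurable_fun [set: Om] (Phi k : Om -> borel G).
Hypothesis mPsi : forall k, measurable_fun [set: Om] (Psi k : Om -> borel X).
Hypothesis PPsi : forall k (B : set (borel X)), measurable B ->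
  P (Psi k @^-1` B) = mm_measure X B.
Hypothesis Xfull : fully_supported X.
Hypothesis Xcompact : mm_compact X.
Local Notation tracks := (tracks P Phi Psi U).
Hypothesis almost_invariant : forall g (f : G -> R), lip1 G f ->
  (forall x, `|f x| <= 1) -> forall e : R, 0 < e -> \forall k \near U,
    `|\int[P]_w f (g * Phi k w)%g - \int[P]_w f (Phi k w)| <= e.

Lemma close_Rintegral (k : nat) (M e : R) (f : G -> R) (h : X -> R) :
  0 <= M -> 0 <= e -> continuous f -> continuous h -> (forall x, `|f x| <= M) ->
  (forall y, `|h y| <= M) -> close P Phi Psi k e f h ->
  `|\int[P]_w f (Phi k w) - \int[mm_measure X]_y h y| <= e + 2 * M * e.
Proof.
move=> M0 e0 cf ch fM hM [N [mN PN fh]].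
have mf := continuous_measurable_borel cf.
have mh := continuous_measurable_borel ch.
rewrite (Rintegral_law (mPsi k) (PPsi k) mh hM).
apply: (Rintegral_dist mN) => //.
- exact: (measurableT_comp mf (mPhi k)).
- exact: (measurableT_comp mh (mPsi k)).
Qed.

Lemma rucb_continuous (f : RUCB R G) : continuous f.
Proof.
have /(rucb_metricP rinv)[_ uf] := rucb_valP f.
apply: continuous_metricP => x e e0.
have [r r0 rf] := uf (e / 2) (divr_gt0 e0 (ltr0n _ 2)).
exists r => // y /rf /le_lt_trans; apply.
by rewrite ltr_pdivrMr// ltr_pMr// ltr1n.
Qed.

(** The integrals of [h] and [h'] are close to those of [f] and its translate along [Phi k]. To
    compare the latter two, [f] is replaced by a Lipschitz function [f1], to which almost invariance
    applies after rescaling. *)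
Lemma tracks_invariant (M : R) (g : G) (f : RUCB R G) (h h' : X -> R) :
  continuous h -> continuous h' -> (forall x, `|f x| <= M) ->
  (forall y, `|h y| <= M) -> (forall y, `|h' y| <= M) ->
  tracks f h -> tracks (rucb_ltrans g f) h' ->
  \int[mm_measure X]_y h y = \int[mm_measure X]_y h' y.
Proof.
move=> ch ch' fM hM h'M fh fh'.
have M0 : 0 <= M := le_trans (normr_ge0 _) (fM point).
apply/eqP; rewrite -subr_eq0 -normr_le0; apply/ler_addgt0Pr => e0 e00.
(* Two passages between [G] and [X] cost [e + 2 * M * e] each; two replacements of [f] by [f1] and
   the almost invariance of [f1] cost [e] each. *)
rewrite add0r; pose e := e0 / (4 * M + 5).
have eE : e * (4 * M + 5) = e0 by rewrite /e divfK// gt_eqF// ltr_wpDl// mulr_ge0.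
have e1 : 0 < e by rewrite divr_gt0// ltr_wpDl// mulr_ge0.
have /(rucb_metricP rinv)[_ /(_ e e1)[r r0 rf]] := rucb_valP f.
have [L [f1 [L0 lf1 f1f ff1]]] := lipschitz_approximation r0 (ltW e1) fM rf.
(* Division by [c] makes [f1] both 1-Lipschitz and bounded by 1. *)
pose c := L + M + e + 1; have c0 : 0 < c by rewrite ltr_wpDl// !addr_ge0// ltW.
have f1M x : `|f1 x| <= M + e.
  have := f1f x; have := ff1 x; have := fM x.
  by rewrite !ler_norml => /andP[? ?] ? ?; apply/andP; split; move: e1; lra.
have lf2 : lip1 G (fun x => c^-1 * f1 x).
  apply/lip1_lipschitz; apply: lipschitz_withW (lipschitz_scale c^-1 lf1).
  by rewrite ger0_norm ?invr_ge0 ?(ltW c0)// ler_pdivrMl// mulr1 /c; move: e1; lra.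
have f2M x : `|c^-1 * f1 x| <= 1.
  rewrite normrM ger0_norm ?invr_ge0 ?(ltW c0)// ler_pdivrMl// mulr1.
  by apply: le_trans (f1M x) _; rewrite /c; move: L0; lra.
have ec0 : 0 < e / c by rewrite divr_gt0.
have [k [[fhk fh'k] invk]] := filter_ex
  (filterI (filterI (fh _ e1) (fh' _ e1)) (almost_invariant g lf2 f2M ec0)).
have cf := @rucb_continuous f; have cgf := @rucb_continuous (rucb_ltrans g f).
have gM x : `|rucb_ltrans g f x| <= M by exact: fM.
have i1 := close_Rintegral M0 (ltW e1) cf ch fM hM fhk.
have i2 := close_Rintegral M0 (ltW e1) cgf ch' gM h'M fh'k.
have mf1 := continuous_measurable_borel (lipschitz_continuous lf1).
have mf := continuous_measurable_borel cf.
have mgf := continuous_measurable_borel cgf.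
have mg : measurable_fun [set: borel G] (ltrans g) by exact: measurable_funPT.
have Me0 : 0 <= M + e by rewrite addr_ge0// ltW.
have fMe x : `|f x| <= M + e by rewrite (le_trans (fM x))// lerDl ltW.
have ff1e x : `|f x - f1 x| <= e.
  have := f1f x; have := ff1 x.
  by rewrite !ler_norml => ? ?; apply/andP; split; move: e1; lra.
have P0 : (P set0 <= 0%:E)%E by rewrite measure0.
have mf1k := measurableT_comp mf1 (mPhi k).
have mgf1k : measurable_fun setT (fun w => f1 (g * Phi k w)%g).
  exact: (measurableT_comp mf1 (measurableT_comp mg (mPhi k))).
have i3 : `|\int[P]_w f (Phi k w) - \int[P]_w f1 (Phi k w)| <= e + 2 * (M + e) * 0.
  apply: (@Rintegral_dist _ _ _ P _ _ _ _ _ set0) => //; first exact: ltW.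
  exact: (measurableT_comp mf (mPhi k)).
have i4 : `|\int[P]_w rucb_ltrans g f (Phi k w) - \int[P]_w f1 (g * Phi k w)%g|
    <= e + 2 * (M + e) * 0.
  apply: (@Rintegral_dist _ _ _ P _ _ _ _ _ set0) => //; first exact: ltW.
  - exact: (measurableT_comp mgf (mPhi k)).
  - by move=> w; exact: fMe.
  - by move=> w _; exact: ff1e.
have i5 : `|\int[P]_w f1 (g * Phi k w)%g - \int[P]_w f1 (Phi k w)| <= e.
  have I1 : P.-integrable setT (EFin \o (fun w => f1 (Phi k w))).
    by apply: (bounded_integrable P mf1k) => w; exact: f1M.
  have I2 : P.-integrable setT (EFin \o (fun w => f1 (g * Phi k w)%g)).
    by apply: (bounded_integrable P mgf1k) => w; exact: f1M.
  move: invk; rewrite (RintegralZl _ measurableT I1) (RintegralZl _ measurableT I2).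
  rewrite -mulrBr normrM ger0_norm ?invr_ge0 ?(ltW c0)// mulrC.
  by rewrite ler_pM2r ?invr_gt0.
have eE' : e0 = 4 * (M * e) + 5 * e by rewrite -eE; ring.
move: i1 i2 i3 i4 i5; rewrite mulr0 addr0 eE'.
set a1 := \int[P]_w f (Phi k w); set a2 := \int[P]_w rucb_ltrans g f (Phi k w).
set a3 := \int[P]_w f1 (Phi k w); set a4 := \int[P]_w f1 (g * Phi k w)%g.
set b1 := \int[mm_measure X]_y h y; set b2 := \int[mm_measure X]_y h' y.
move: a1 a2 a3 a4 b1 b2 => a1 a2 a3 a4 b1 b2; clear.
rewrite !ler_norml.
move=> /andP[? ?] /andP[? ?] /andP[? ?] /andP[? ?] /andP[? ?].
by apply/andP; split; lra.
Qed.


Variable T : RUCB R G -> X -> R.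
Hypothesis T_continuous : forall f, continuous (T f).
Hypothesis T_tracks : forall f : RUCB R G, tracks f (T f).

(** The algebraic identities for [T] come from here: in each, the right-hand side is continuous and
    tracked by the argument of [T] on the left. *)
Lemma T_unique (f : RUCB R G) (h : X -> R) :
  continuous h -> tracks f h -> T f = h.
Proof.
move=> ch fh.
by apply: (@tracks_unique R G X d Om P Phi Psi U UU mPsi PPsi Xfull f). Qed.

Lemma T_cst c : T (rucb_cst rinv c) = fun=> c.
Proof.
by apply: T_unique; [move=> x; exact: cvg_cst|exact: tracks_cst].
Qed.

Lemma T_le (c : R) (f f' : RUCB R G) : (forall x, f x <= f' x + c) ->
  forall y, T f y <= T f' y + c.
Proof.
by apply: (@tracks_le R G X d Om P Phi Psi U UU mPsi PPsi Xfull c f f'). Qed.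

Lemma T_bound (M : R) (f : RUCB R G) : (forall x, `|f x| <= M) ->
  forall y, `|T f y| <= M.
Proof.
move=> fM y; pose z : RUCB R G := rucb_cst rinv 0.
have zf x : z x <= f x + M.
  by have := fM x; rewrite ler_norml => /andP[+ _]; rewrite lerNl -subr_ge0 opprK addrC.
have fz x : f x <= z x + M by rewrite add0r (le_trans (ler_norm _)).
have := T_le zf y; have := T_le fz y; rewrite T_cst add0r => fyM fyN.
by rewrite ler_norml fyM andbT lerNl -subr_ge0 opprK addrC.
Qed.

Lemma T_sub (f f' : RUCB R G) : T (f - f') = fun y => T f y - T f' y.
Proof.
apply: T_unique; last exact: (tracksB UU (T_tracks f) (T_tracks f')).
by move=> y; apply: cvgB; exact: T_continuous.
Qed.

Lemma T_mul (f f' : RUCB R G) : T (f * f') = fun y => T f y * T f' y.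
Proof.
apply: T_unique; first by move=> y; apply: cvgM; exact: T_continuous.
have /rucbP[[M fM] _] := rucb_valP f; have /rucbP[[M' fM'] _] := rucb_valP f'.
apply: (@tracksM R G X d Om P Phi Psi U UU (Num.max M M') _ _ _ _ _ _
  (T_tracks f) (T_tracks f')) => x.
  by rewrite le_max fM.
by rewrite le_max (T_bound fM') orbT.
Qed.

Lemma T_max (c : R) (f : RUCB R G) :
  T (rucb_max rinv c f) = fun y => Num.max c (T f y).
Proof.
apply: T_unique; last exact: (tracks_max UU c (T_tracks f)).
by move=> y; apply: continuous_max; [exact: cvg_cst|exact: T_continuous].
Qed.

Lemma T_integral_invariant (g : G) (f : RUCB R G) :
  \int[mm_measure X]_y T f y = \int[mm_measure X]_y T (rucb_ltrans g f) y.
Proof.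
have /rucbP[[M fM] _] := rucb_valP f.
have gM x : `|rucb_ltrans g f x| <= M by exact: fM.
apply: (@tracks_invariant M g f) => //; first exact: T_bound.
exact: T_bound.
Qed.

End representation.

(** * Points of the limit space as characters, and the action of the group on them *)

Section characters.
Context {R : realType} {G : metricGroupType R} {X : mmSpace R}.
Hypothesis rinv : right_invariant_metric G.
Hypothesis Xfull : fully_supported X.
Hypothesis Xcompact : mm_compact X.
Variable T : RUCB R G -> X -> R.
Hypothesis T_continuous : forall f, continuous (T f).
Hypothesis T_cst : forall c, T (rucb_cst rinv c) = fun=> c.
Hypothesis T_le : forall (c : R) (f f' : RUCB R G),
  (forall x, f x <= f' x + c) -> forall y, T f y <= T f' y + c.
Hypothesis T_sub : forall f f', T (f - f') = fun y => T f y - T f' y.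
Hypothesis T_mul : forall f f', T (f * f') = fun y => T f y * T f' y.
Hypothesis T_max : forall c f,
  T (rucb_max rinv c f) = fun y => Num.max c (T f y).
Hypothesis T_integral_invariant : forall g f,
  \int[mm_measure X]_y T f y = \int[mm_measure X]_y T (rucb_ltrans g f) y.
Hypothesis T_lipschitz : forall (L : R) (h : X -> R), lipschitz_with L h ->
  exists f, T f = h.

Lemma T_ge0 (f : RUCB R G) : (forall x, 0 <= f x) -> forall y, 0 <= T f y.
Proof.
move=> f0 y; have := @T_le 0 (rucb_cst rinv 0) f _ y.
by rewrite T_cst addr0; apply => w; rewrite addr0; exact: f0.
Qed.

Lemma rucb_cst0 : rucb_cst rinv 0 = 0 :> RUCB R G.
Proof. by apply/val_inj/funext. Qed.

Lemma T_add (f f' : RUCB R G) : T (f + f') = fun y => T f y + T f' y.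
Proof.
have -> : f + f' = f - (0 - f') by rewrite sub0r opprK.
by apply/funext => y; rewrite !T_sub -rucb_cst0 T_cst sub0r opprK.
Qed.

Let psi_fun (x : X) (f : RUCB R G) : R := T f x.

Let psi_funB x : zmod_morphism (psi_fun x).
Proof. by move=> f f'; rewrite /psi_fun T_sub. Qed.

Let psi_funM x : monoid_morphism (psi_fun x).
Proof.
split=> [|f f']; last by rewrite /psi_fun T_mul.
rewrite /psi_fun (_ : 1 = rucb_cst rinv 1) ?T_cst//.
by apply/val_inj/funext.
Qed.

Definition character_map (x : X) : samuel R G :=
  samuel_of (psi_funB x) (psi_funM x).

Lemma character_mapE x f : character_map x f = T f x.
Proof. by []. Qed.

(** Each distance function [mdist x] is [T (F x)] for some [F x]. Evaluation at [F x] separates [x]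
    from other points, and the condition [zeta (F x) < e] cuts the ball of radius [e] about [x] out
    of the image. *)
Lemma character_map_embedding : embedding character_map.
Proof.
have /choice[F FE] (x : X) : exists f, T f = mdist x
  by apply: (T_lipschitz (L := 1)); apply/lip1_lipschitz/mdist_lip1.
split.
- move=> x y xy; apply: mdist_positivity.
  have : character_map x (F x) = character_map y (F x) by rewrite xy.
  by rewrite !character_mapE FE mdistxx.
- by apply: samuel_continuousP => f; exact: T_continuous.
move=> V oV; pose r x := [set e : R | 0 < e /\ ball x e `<=` V].
exists (\bigcup_(xe in [set xe : X * R | V xe.1 /\ r xe.1 xe.2])
    [set zeta : samuel R G | zeta (F xe.1) < xe.2]).
  apply: bigcup_open => -[x e] _ /=.
  have /continuousP := @samuel_eval_continuous R G (F x).
  move=> /(_ `]-oo, e[%classic (interval_open _ _)).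
  rewrite (_ : _ @^-1` _ = [set zeta : samuel R G | zeta (F x) < e]); first exact.
  by apply/seteqP; split => zeta /=; rewrite in_itv.
apply/seteqP; split => [_ [x Vx <-]|_ [[y _ <-] [[x e] /= [Vx [e0 rV]]]]].
  split; first by exists x.
  have : nbhs x V by exact: open_nbhs_nbhs.
  rewrite -metricType_numDomainType.filter_from_mdist_nbhs => -[e /= e0 eV].
  have xFx : character_map x (F x) < e by rewrite character_mapE FE mdistxx.
  exists (x, e); last exact: xFx.
  by split => //; split => // y; rewrite ballEmdist; exact: eV.
rewrite /= /psi_fun FE => xy; exists y => //; apply: rV.
by rewrite ballEmdist.
Qed.

(** The image under [T] of the translate is continuous and nonnegative, and its mean equals that of
    [T f], which is zero; full support makes it vanish. *)
Lemma T_zero_invariant (g : G) (f : RUCB R G) : (forall x, 0 <= f x) ->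
  T f = (fun=> 0) -> T (rucb_ltrans g f) = fun=> 0.
Proof.
move=> f0 Tf0; have /rucbP[[M fM] _] := rucb_valP f.
apply/funext; apply: (continuous_integral_eq0 (M := M) Xfull) => //.
- by apply: T_ge0 => x; exact: f0.
- have fM' x : rucb_ltrans g f x <= rucb_cst rinv 0 x + M.
    by rewrite add0r (le_trans (ler_norm _))// fM.
  by move=> y; have := T_le fM' y; rewrite T_cst add0r.
by rewrite -T_integral_invariant Tf0 Rintegral_cst// mul0r.
Qed.

(* Otherwise [T F >= c > 0] by compactness, and then [max(0, c - F)] lies in the
   kernel of [T], but its translate does not. *)
Lemma T_ltrans_zero (g : G) (x : X) (F : RUCB R G) :
  T (rucb_ltrans g F) x = 0 -> (forall z, 0 <= F z) -> exists y, T F y = 0.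
Proof.
move=> TF0 F0; have [|||y _ ymin] := @compact_EVT_min X R (T F) setT.
- by exists point.
- exact: Xcompact.
- by apply: continuous_subspaceT; exact: T_continuous.
exists y; apply/eqP; rewrite eq_le T_ge0// andbT.
pose F' := rucb_max rinv 0 (rucb_cst rinv (T F y) - F).
have /(T_zero_invariant g) F'0 : forall z, 0 <= F' z.
  by move=> z; rewrite /= le_max lexx.
have TF'0 : T F' = fun=> 0.
  rewrite T_max T_sub T_cst; apply/funext => z; apply/max_idPl.
  by rewrite subr_le0; apply: ymin; exact: mem_set.
have := F'0 TF'0.
have -> : rucb_ltrans g F' =
    rucb_max rinv 0 (rucb_cst rinv (T F y) - rucb_ltrans g F).
  by apply/val_inj/funext.
rewrite T_max T_sub T_cst => /(congr1 (fun h => h x)); rewrite TF0 subr0.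
by move=> /max_idPl.
Qed.

(* Compactness, applied to the zero sets of the [T F] with [F >= 0] and
   [T (F o lambda_g) x = 0]; the given [f] enters through [F := (f - c)^2]. *)
Lemma T_orbit (g : G) (x : X) : exists y, forall f, T f y = T (rucb_ltrans g f) x.
Proof.
pose D := [set F : RUCB R G | (forall z, 0 <= F z) /\ T (rucb_ltrans g F) x = 0].
pose Z (F : RUCB R G) : set X := [set y | T F y = 0].
have ltrans_cst c : rucb_ltrans g (rucb_cst rinv c) = rucb_cst rinv c.
  by apply/val_inj/funext.
have PF : ProperFilter (filter_from D Z).
  apply: filter_from_proper; last by move=> F [F0 FT]; exact: (T_ltrans_zero FT F0).
  apply: filter_from_filter.
    by exists (rucb_cst rinv 0); split => //; rewrite ltrans_cst T_cst.
  move=> F F' [F0 FT] [F'0 F'T]; exists (F + F').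
    split=> [z|]; first exact: (addr_ge0 (F0 z) (F'0 z)).
    by rewrite rmorphD T_add FT F'T addr0.
  move=> y; rewrite /Z /= T_add => /eqP.
  by rewrite paddr_eq0 ?T_ge0// => /andP[/eqP ? /eqP ?].
have [y [_ cly]] := Xcompact PF filterT.
exists y => f; pose c := T (rucb_ltrans g f) x.
pose F := (f - rucb_cst rinv c) * (f - rucb_cst rinv c).
have DF : D F.
  split => [z|]; first exact: sqr_ge0.
  have -> : rucb_ltrans g F =
      (rucb_ltrans g f - rucb_cst rinv c) * (rucb_ltrans g f - rucb_cst rinv c).
    by apply/val_inj/funext.
  by rewrite T_mul T_sub T_cst subrr mul0r.
have cZ : closed (Z F).
  have -> : Z F = T F @^-1` [set 0] by [].
  apply: closed_comp; last exact: closed_eq.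
  by move=> z _; exact: T_continuous.
have : Z F y by apply: cZ => B yB; apply: cly => //; exists F.
rewrite /Z /= /F T_mul T_sub T_cst => /eqP; rewrite mulf_eq0 orbb subr_eq0.
by move=> /eqP.
Qed.

End characters.

(** * Preservation of a measure, tested on Lipschitz functions *)

Section measure_preservation.
Context {R : realType} {X : pmetricType R}.
Variables (mu : probability (borel X) R) (a : X -> X).
Hypothesis ma : measurable_fun [set: borel X] (a : borel X -> borel X).

(** The sequence is eventually constant: it is 0 outside [V], and if the ball of radius [e] about
    [x] lies in [V], it is 1 as soon as [n * e >= 1]. *)
Lemma mcshane_indic_cvg (V : set X) (x : X) : open V ->
  mcshane n%:R setT (\1_V : X -> R) x @[n --> \oo] --> (\1_V x : R).
Proof.
move=> oV; have V0 y : [set: X] y -> `|\1_V y : R| <= 1.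
  by rewrite indicE ger0_norm//; case: (_ \in _).
have T0 : [set: X] !=set0 by exists x.
apply: cvg_near_cst.
have [Vx|nVx] := pselect (V x); last first.
  apply: nearW => n; apply/eqP; rewrite indicE memNset//= eq_le.
  have := mcshane_le (ler0n R n) V0 x (I : setT x).
  rewrite mdistxx mulr0 addr0 indicE memNset//= => ->/=.
  by apply: mcshane_ge => // y _; rewrite addr_ge0 ?mulr_ge0 ?mdist_ge0.
have : nbhs x V by exact: open_nbhs_nbhs.
rewrite -metricType_numDomainType.filter_from_mdist_nbhs => -[e /= e0 eV].
exists (Num.bound e^-1) => // n /= en; apply/eqP; rewrite eq_le; apply/andP; split.
  have := mcshane_le (ler0n R n) V0 x (I : setT x).
  by rewrite mdistxx mulr0 addr0.
apply: mcshane_ge => // y _; rewrite !indicE mem_set//.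
have [xy|xy] := ltP (mdist x y) e.
  by rewrite mem_set ?lerDl ?mulr_ge0 ?mdist_ge0//; exact: eV.
rewrite ler_wpDl//; apply: (@le_trans _ _ (n%:R * e)); last by rewrite ler_wpM2l.
rewrite -ler_pdivrMr// mul1r; apply: (@le_trans _ _ (Num.bound e^-1)%:R).
  by rewrite ltW// archi_boundP// invr_ge0 ltW.
by rewrite ler_nat.
Qed.

(** Lipschitz regularizations of the indicator of an open set and dominated convergence give the
    equality on open sets; these are closed under intersection and generate the Borel sets, so the
    two measures agree. *)
Lemma lipschitz_measure_preserving :
  (forall L (h : X -> R), lipschitz_with L h -> (forall x, `|h x| <= 1) ->
    \int[mu]_x h x = \int[mu]_x h (a x)) ->
  forall B : set (borel X), measurable B -> mu (a @^-1` B) = mu B.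
Proof.
move=> mu_a.
have openP (V : set X) : open V -> mu (a @^-1` V) = mu V.
  move=> oV; have mV : measurable (V : set (borel X)) by exact: open_borel.
  have maV : measurable (a @^-1` V : set (borel X)).
    by rewrite -[X in measurable X]setTI; exact: ma.
  have V0 y : [set: X] y -> `|\1_V y : R| <= 1.
    by rewrite indicE ger0_norm//; case: (_ \in _).
  pose h n := mcshane n%:R setT (\1_V : X -> R).
  have T0 : [set: X] !=set0 by exists point.
  have h1 n x : `|h n x| <= 1.
    rewrite ger0_norm; last first.
      by apply: mcshane_ge => // y _; rewrite addr_ge0 ?mulr_ge0 ?mdist_ge0.
    apply: le_trans (mcshane_le (ler0n R n) V0 x (I : setT x)) _.
    rewrite mdistxx mulr0 addr0; exact: le_trans (ler_norm _) (V0 x I).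
  have lh n : lipschitz_with n%:R (h n) by exact: mcshane_lipschitz (ler0n R n) T0 V0.
  have mh n := continuous_measurable_borel (lipschitz_continuous (lh n)).
  have mha n := measurableT_comp (mh n) ma.
  have cst1 : mu.-integrable setT (EFin \o (fun=> 1 : R)).
    exact: probability_integrable_cst.
  have cvg1 : (\int[mu]_x (h n x)%:E)%E @[n --> \oo] --> (\int[mu]_x (\1_V x)%:E)%E.
    apply: (@dominated_cvg _ (borel X) _ mu setT measurableT
      (fun n x => (h n x)%:E) (fun x => (\1_V x)%:E) (EFin \o (fun=> 1))) => //.
    - by move=> n; apply/measurable_EFinP; exact: mh.
    - by move=> x _; apply: cvg_EFin; [exact: nearW|exact: mcshane_indic_cvg].
    - by move=> n x _; rewrite lee_fin h1.
  have cvg2 : (\int[mu]_x (h n (a x))%:E)%E @[n --> \oo] -->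
      (\int[mu]_x (\1_(a @^-1` V) x)%:E)%E.
    apply: (@dominated_cvg _ (borel X) _ mu setT measurableT
      (fun n x => (h n (a x))%:E) (fun x => (\1_(a @^-1` V) x)%:E)
      (EFin \o (fun=> 1))) => //.
    - by move=> n; apply/measurable_EFinP; exact: mha.
    - by move=> x _; apply: cvg_EFin; [exact: nearW|exact: mcshane_indic_cvg].
    - by move=> n x _; rewrite lee_fin h1.
  move: cvg1 cvg2; rewrite !integral_indic// !setIT.
  have -> : (fun n => \int[mu]_x (h n (a x))%:E)%E = (fun n => \int[mu]_x (h n x)%:E)%E.
    apply/funext => n.
    have f1 : (\int[mu]_x (h n x)%:E)%E \is a fin_num.
      exact: integrable_fin_num (bounded_integrable mu (mh n) (h1 n)).
    have f2 : (\int[mu]_x (h n (a x))%:E)%E \is a fin_num.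
      by apply: integrable_fin_num => //;
        apply: (bounded_integrable mu (mha n)) => x; exact: h1.
    by rewrite -(fineK f1) -(fineK f2); congr EFin; exact/esym/(mu_a _ _ (lh n) (h1 n)).
  by move=> c1 c2; apply: cvg_unique c2 c1.
move=> B mB.
have setTI' : setI_closed (@open X) by move=> ? ?; exact: openI.
apply: (@measure_unique _ R (borel X) open (fun=> setT) _ setTI' _ _
  (pushforward mu (a : borel X -> borel X)) mu) => //.
- by move=> _; exact: openT.
- by rewrite bigcup_const.
- by move=> _; exact: le_lt_trans (probability_le1 mu measurableT) (ltry 1).
Qed.

End measure_preservation.

(** * Invariance of the image and of the push-forward measure *)

Section invariant_image.
Context {R : realType} {G : metricGroupType R} {X : mmSpace R}.
Variable psi : X -> samuel R G.
Hypothesis psi_lipschitz : forall (L : R) (h : X -> R), lipschitz_with L h ->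
  exists f, forall x, psi x f = h x.
Hypothesis psi_continuous : forall f, continuous (fun x => psi x f).
Hypothesis psi_orbit : forall g x, exists y, samuel_act g (psi x) = psi y.
Hypothesis psi_integral : forall g f,
  \int[mm_measure X]_x psi x f = \int[mm_measure X]_x psi x (rucb_ltrans g f).

Lemma samuel_actK g (xi : samuel R G) :
  samuel_act g (samuel_act g^-1%g xi) = xi.
Proof.
apply: samuel_ext => f; rewrite /samuel_act /=; congr (xi _).
by apply/val_inj/funext => x /=; rewrite mulgA mulgV mul1g.
Qed.

Lemma psi_range g : samuel_act g @` range psi = range psi.
Proof.
apply/seteqP; split => [_ [_ [x _ <-] <-]|_ [x _ <-]].
  by have [y ->] := psi_orbit g x; exists y.
have [y xy] := psi_orbit g^-1%g x.
by exists (psi y); [exists y|rewrite -xy samuel_actK].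
Qed.

(** Through [psi], the action of [g] becomes a map [a] on [X]. It is continuous, because
    [mdist (a x) (a z)] is the value of [psi z] at the translate of a function representing
    [mdist (a x)]; it preserves the measure, because it preserves the means of Lipschitz
    functions. *)
Lemma psi_invariant : invariant_measure
  (pushforward (mm_measure X) (psi : borel X -> borel (samuel R G))).
Proof.
move=> g B mB; have /choice[a aP] := psi_orbit g.
have ca : continuous a.
  move=> x; have [f fE] := psi_lipschitz ((lip1_lipschitz _).1 (mdist_lip1 (a x))).
  have fa z : mdist (a x) (a z) = psi z (rucb_ltrans g f) by rewrite -fE -aP.
  apply/metricType_numDomainType.cvgrPdist_lt => e e0.
  have /cvgrPdist_lt/(_ e e0) := @psi_continuous (rucb_ltrans g f) x.
  apply: filterS => z; rewrite -!fa mdistxx sub0r normrN ger0_norm//.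
  exact: mdist_ge0.
have ma := continuous_borel ca.
have mpsi := continuous_borel (samuel_continuousP psi_continuous).
have mpB : measurable (psi @^-1` B : set (borel X)).
  by rewrite -[X in measurable X]setTI; exact: mpsi.
rewrite /pushforward.
have -> : psi @^-1` (samuel_act g @^-1` B) = a @^-1` (psi @^-1` B).
  by apply/seteqP; split => x /=; rewrite aP.
apply: (lipschitz_measure_preserving ma) => // L h lh h1.
have [f fE] := psi_lipschitz lh.
transitivity (\int[mm_measure X]_x psi x f).
  by apply: eq_Rintegral => x _; rewrite fE.
by rewrite (psi_integral g); apply: eq_Rintegral => x _; rewrite -fE -aP.
Qed.

End invariant_image.

(** * Consequences of convergence to invariance: separating translations and common extensions *)

Section mass_transportation.
Context {R : realType} {G : metricGroupType R}.

Lemma d_MT_ltrans (mu : probability (borel G) R) (g : G) (f : G -> R) :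
  lip1 G f -> (forall x, `|f x| <= 1) ->
  `|\int[mu]_x f (g * x)%g - \int[mu]_x f x| <=
    d_MT (distribution mu (ltrans g)) mu.
Proof.
move=> lf f1; pose nu := distribution mu (ltrans g).
have Rint_bound (m : probability (borel G) R) (h : G -> R) : lip1 G h ->
    (forall x, -1 <= h x <= 1) -> `|\int[m]_x h x| <= 1.
  move=> lh h1; have mh := continuous_measurable_borel
    (lipschitz_continuous ((lip1_lipschitz h).1 lh)).
  have h1' x : `|h x| <= 1 by rewrite ler_norml.
  have P0 : (m set0 <= 0%:E)%E by rewrite measure0.
  have := @Rintegral_dist _ _ (borel G) m h (fun=> 0) 1 1 0 set0 measurable0
    ler01 ler01 mh (measurable_cst _) h1' _ P0.
  rewrite Rintegral_cst// mul0r mulr0 addr0 subr0; apply => x.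
    by rewrite normr0.
  by move=> _; rewrite subr0.
have -> : \int[mu]_x f (g * x)%g = \int[nu]_x f x.
  have mf := continuous_measurable_borel
    (lipschitz_continuous ((lip1_lipschitz f).1 lf)).
  have mg : measurable_fun [set: borel G] (ltrans g) by exact: measurable_funPT.
  exact/esym/(Rintegral_law mg _ mf f1).
rewrite /d_MT; apply: ub_le_sup; last first.
  by exists f => //; split => // x; rewrite -ler_norml.
(* The supremum defining [d_MT] is over a set bounded by 2, since each integral lies between -1 and
   1. *)
exists 2 => _ [h [lh h1] <-]; rewrite (le_trans (ler_normB _ _))//.
by rewrite (_ : 2 = 1 + 1)//; apply: lerD; exact: Rint_bound.
Qed.

Lemma integrable_sum_seq d (T : measurableType d) (P : probability T R)
    (I : Type) (s : seq I) (F : I -> T -> R) :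
  (forall i, P.-integrable setT (EFin \o F i)) ->
  P.-integrable setT (EFin \o (fun x => \sum_(i <- s) F i x)) /\
  \int[P]_x (\sum_(i <- s) F i x) = \sum_(i <- s) \int[P]_x F i x.
Proof.
move=> iF; elim: s => [|i s [iS IH]].
  split; last first.
    rewrite big_nil; under eq_Rintegral do rewrite big_nil.
    by rewrite Rintegral_cst// mul0r.
  apply: (eq_integrable _ (EFin \o (fun=> 0))) => //; last exact: integrable0.
  by move=> x _; rewrite /= big_nil.
split.
  have := integrableD measurableT (iF i) iS.
  by apply: eq_integrable => // x _; rewrite /= big_cons EFinD.
rewrite big_cons -IH -RintegralD//; apply: eq_Rintegral => x _.
by rewrite big_cons.
Qed.

Hypothesis rinv : right_invariant_metric G.
Variable mu : nat -> probability (borel G) R.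
Hypothesis cvg_invariance : forall g : G,
  d_MT (distribution (mu n) (ltrans g)) (mu n) @[n --> \oo] --> (0 : R).

Lemma lipschitz_almost_invariant (g : G) (L M e : R) (f : G -> R) : 0 < e ->
  lipschitz_with L f -> (forall x, `|f x| <= M) ->
  \forall n \near \oo, `|\int[mu n]_x f (g * x)%g - \int[mu n]_x f x| <= e.
Proof.
move=> e0 lf fM; pose c := `|L| + M + 1.
have M0 : 0 <= M := le_trans (normr_ge0 _) (fM point).
have c0 : 0 < c by rewrite ltr_wpDl// addr_ge0.
have lf1 : lip1 G (fun x => c^-1 * f x).
  apply/lip1_lipschitz; apply: lipschitz_withW (lipschitz_scale c^-1 lf).
  rewrite ger0_norm ?invr_ge0 ?(ltW c0)// ler_pdivrMl// mulr1 /c.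
  by have := ler_norm L; move: M0; lra.
have f1 x : `|c^-1 * f x| <= 1.
  rewrite normrM ger0_norm ?invr_ge0 ?(ltW c0)// ler_pdivrMl// mulr1.
  by rewrite (le_trans (fM x))// /c -addrA addrCA lerDl addr_ge0.
have ec0 : 0 < e / c by rewrite divr_gt0.
have /cvgrPdist_le/(_ _ ec0) := cvg_invariance g.
apply: filterS => n; rewrite sub0r normrN => dn.
have := le_trans (d_MT_ltrans (mu n) g lf1 f1) (le_trans (ler_norm _) dn).
have cf := lipschitz_continuous lf.
have mf := continuous_measurable_borel cf.
have mg : measurable_fun [set: borel G] (ltrans g) by exact: measurable_funPT.
have I1 : (mu n).-integrable setT (EFin \o f) := bounded_integrable (mu n) mf fM.
have I2 : (mu n).-integrable setT (EFin \o (fun x => f (g * x)%g)).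
  by apply: (bounded_integrable (mu n) (measurableT_comp mf mg)) => x; exact: fM.
rewrite (RintegralZl _ measurableT I1) (RintegralZl _ measurableT I2).
rewrite -mulrBr normrM ger0_norm ?invr_ge0 ?(ltW c0)// mulrC.
by rewrite ler_pM2r ?invr_gt0.
Qed.

(** For [e > 0], a Lipschitz substitute for the indicator of the ball of radius [e] about [c]: the
    peak value 2 makes it at least 1 on that ball, and it vanishes from distance [2 * e] on. *)
Definition bump (e : R) (c x : G) : R := Num.max 0 (2 - e^-1 * mdist c x).

Lemma bump_ge0 e c x : 0 <= bump e c x.
Proof. by rewrite le_max lexx. Qed.

Lemma bump_le2 e c x : 0 < e -> bump e c x <= 2.
Proof.
move=> e0; rewrite ge_max ler0n/= gerBl mulr_ge0 ?mdist_ge0// invr_ge0.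
exact: ltW.
Qed.

Lemma bump_ge1 e c x : 0 < e -> mdist c x < e -> 1 <= bump e c x.
Proof.
move=> e0 /ltW cx; rewrite le_max; apply/orP; right.
have : e^-1 * mdist c x <= 1 by rewrite ler_pdivrMl// mulr1.
by lra.
Qed.

Lemma bump_eq0 e c x : 0 < e -> 2 * e <= mdist c x -> bump e c x = 0.
Proof.
move=> e0 cx; apply/max_idPl; rewrite subr_le0 ler_pdivlMl// mulrC.
exact: cx.
Qed.

Lemma bump_lipschitz e c : lipschitz_with `|e^-1| (bump e c).
Proof.
move=> x y; apply: (le_trans (max_dist _ _ _)).
rewrite (_ : _ - _ = e^-1 * (mdist c y - mdist c x)); last by ring.
rewrite normrM distrC.
by rewrite ler_wpM2l//; exact: mdist_lip1.
Qed.

(** For some [d] no finite set is a [d]-net, so a finite [d]-separated sequence can always be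
    prolonged by one point. *)
Lemma separated_seq : ~ totally_bounded [set: G] ->
  exists2 d : R, 0 < d & forall N : nat, exists2 s : seq G, size s = N &
    pairwise (fun x y => d <= mdist x y) s.
Proof.
move=> /existsNP[d /not_implyP[d0 /forallNP nd]]; exists d => // N.
elim: N => [|N [s sN ps]]; first by exists [::].
have /existsNP[x /not_implyP[_ xs]] := nd s.
exists (x :: s); first by rewrite /= sN.
rewrite /= ps andbT; apply/allP => y ys; rewrite leNgt; apply/negP => xy.
by apply: xs; exists y.
Qed.

(* If every [r] had [k r] within [e] of [c] for some [k], [c] in the finite sets
   [F], [F'], then the translates by [F] of the bumps at [F'] would cover [G], so
   some bump would have nonnegligible mass; by almost invariance, so would its
   translates by a long [4 e]-separated sequence, but these have disjoint
   supports. *)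
Lemma translate_away_seq : ~ totally_bounded [set: G] ->
  exists2 e : R, 0 < e & forall F F' : seq G, exists r : G,
    forall k c, k \in F -> c \in F' -> e <= mdist (k * r)%g c.
Proof.
move=> /separated_seq[d d0 sepd]; pose e := d / 4.
have e0 : 0 < e by rewrite divr_gt0.
exists e => // F F'; apply: contrapT => /forallNP noR.
(* A bump has mean at most [2 / N + t = 3 * t] and its translates by [F] at most [4 * t], where
   [t = 1 / N]. If the [m] translates cover [G], their means add up to at least 1, so [N <= 4 * m],
   which [N = 8 * m + 1] excludes. *)
pose m := (size F * size F')%N; pose N := (8 * m).+1.
have [H HN pH] := sepd N.
pose t : R := N%:R^-1; have t0 : 0 < t by rewrite invr_gt0.
have b2 c x : `|bump e c x| <= 2 by rewrite ger0_norm ?bump_ge0// bump_le2.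
have : \forall n \near \oo, forall gc, gc \in [seq (g, c) | g <- F ++ H, c <- F'] ->
    `|\int[mu n]_x bump e gc.2 (gc.1 * x)%g - \int[mu n]_x bump e gc.2 x| <= t.
  apply: filter_forall_seq => -[g c] /=.
  exact: lipschitz_almost_invariant t0 (bump_lipschitz e c) (b2 c).
move=> /filter_ex[n inv].
have {}inv g c : g \in F ++ H -> c \in F' ->
    `|\int[mu n]_x bump e c (g * x)%g - \int[mu n]_x bump e c x| <= t.
  by move=> gFH cF'; apply: (inv (g, c)); exact: allpairs_f.
have mb c := continuous_measurable_borel (lipschitz_continuous (bump_lipschitz e c)).
have mg (g : G) : measurable_fun [set: borel G] (ltrans g) by exact: measurable_funPT.
have ib c g : (mu n).-integrable setT (EFin \o (fun x => bump e c (g * x)%g)).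
  by apply: (bounded_integrable (mu n) (measurableT_comp (mb c) (mg g))) => x; exact: b2.
have icst (a : R) : (mu n).-integrable setT (EFin \o (fun=> a)).
  exact: probability_integrable_cst.
have cst_int (a : R) : \int[mu n]_x a = a.
  exact: probability_Rintegral_cst.
have small c : c \in F' -> \int[mu n]_x bump e c x <= 3 * t.
  (* By right invariance the points [h * x] are at mutual distance at least [d = 4 * e], so at most
     one of them is within less than [2 * e] of [c], and at most one term is nonzero. *)
  move=> cF'; have sum2 x : \sum_(h <- H) bump e c (h * x)%g <= 2.
    elim: (H) pH => [|h s IH] /=; first by rewrite big_nil.
    move=> /andP[/allP hs ps]; rewrite big_cons.
    have [hx|hx] := leP (2 * e) (mdist c (h * x)%g).
      by rewrite bump_eq0// add0r IH.
    rewrite big_seq big1 ?addr0 ?bump_le2// => h' h's; apply: bump_eq0 => //.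
    have := hs h' h's; rewrite -(rinv h h' x).
    have := metric_triangle (h * x)%g c (h' * x)%g.
    by rewrite (metric_sym (h * x)%g c) /e; move: hx; rewrite /e; lra.
  have [iS sumE] := integrable_sum_seq H (fun h => ib c h).
  have : \sum_(h <- H) \int[mu n]_x bump e c (h * x)%g <= 2.
    rewrite -sumE -[leRHS]cst_int; exact: le_Rintegral.
  have : \sum_(h <- H) (\int[mu n]_x bump e c x - t) <=
      \sum_(h <- H) \int[mu n]_x bump e c (h * x)%g.
    rewrite big_seq [leRHS]big_seq; apply: ler_sum => h hH.
    have := inv h c; rewrite mem_cat hH orbT => /(_ isT cF').
    by rewrite ler_norml => /andP[]; lra.
  rewrite big_const_seq count_predT HN iter_addr_0 => h1 h2.
  have := le_trans h1 h2; rewrite -[X in X <= _]mulr_natl -ler_pdivlMl ?ltr0n// -/t.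
  by lra.
pose W x := \sum_(k <- F) \sum_(c <- F') bump e c (k * x)%g.
have sumF' k := integrable_sum_seq F' (fun c => ib c k).
have [iS sumE] : (mu n).-integrable setT (EFin \o W) /\
    \int[mu n]_x W x = \sum_(k <- F) \sum_(c <- F') \int[mu n]_x bump e c (k * x)%g.
  have [iS ->] := integrable_sum_seq F (fun k => (sumF' k).1).
  by split => //; apply: eq_bigr => k _; rewrite (sumF' k).2.
have large : 1 <= \sum_(k <- F) \sum_(c <- F') \int[mu n]_x bump e c (k * x)%g.
  rewrite -sumE -[leLHS]cst_int; apply: le_Rintegral => // x _.
  have /existsNP[k /existsNP[c]] := noR x.
  move=> /not_implyP[kF /not_implyP[cF' /negP]]; rewrite -ltNge metric_sym => kx.
  rewrite /W (big_rem k)//= (big_rem c)//= -addrA ler_wpDr ?bump_ge1//.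
  rewrite addr_ge0// sumr_ge0// => ? _; first exact: bump_ge0.
  by rewrite sumr_ge0// => ? _; exact: bump_ge0.
have : \sum_(k <- F) \sum_(c <- F') \int[mu n]_x bump e c (k * x)%g <=
    \sum_(k <- F) \sum_(c <- F') (4 * t).
  rewrite big_seq [leRHS]big_seq; apply: ler_sum => k kF.
  rewrite big_seq [leRHS]big_seq; apply: ler_sum => c cF'.
  have := inv k c; rewrite mem_cat kF => /(_ isT cF').
  by have := small c cF'; rewrite ler_norml => ? /andP[]; lra.
rewrite !big_const_seq !count_predT !iter_addr_0 -mulrnA.
move=> /(le_trans large); rewrite -[X in _ <= X]mulr_natl mulnC -/m mulrA.
rewrite ler_pdivlMr ?ltr0n// mul1r -natrM ler_nat /N.
by rewrite ltnNge => /negP; apply; rewrite (mulnC m) leq_mul2r orbT.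
Qed.

(** The finite case is applied to nets of mesh [e / 4] of both sets; right translation does not
    enlarge the mesh, so [e / 2] of the distance remains. *)
Lemma translate_away : ~ totally_bounded [set: G] ->
  exists2 e : R, 0 < e & forall A B : set G,
    totally_bounded A -> totally_bounded B -> exists r : G,
      forall x y, A x -> B y -> e <= mdist (x * r)%g y.
Proof.
move=> /translate_away_seq[e e0 away]; exists (e / 2); first by rewrite divr_gt0.
move=> A B tA tB; have e40 : 0 < e / 4 by rewrite divr_gt0.
have [s sA] := tA _ e40; have [t tB'] := tB _ e40.
have [r rP] := away s t; exists r => x y /sA[x' x's xx'] /tB'[y' y't yy'].
have := rP x' y' x's y't; move: xx' yy'; rewrite -(rinv x x' r).
have := metric_triangle (x' * r)%g (x * r)%g y'.
have := metric_triangle (x * r)%g y y'.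
by rewrite (metric_sym (x' * r)%g (x * r)%g); lra.
Qed.

Lemma totally_bounded_rtrans (A : set G) (r : G) : totally_bounded A ->
  totally_bounded [set (x * r)%g | x in A].
Proof.
move=> tA e /tA[s sA]; exists [seq (x * r)%g | x <- s] => _ [x /sA[y ys xy] <-].
by exists (y * r)%g; [exact: map_f|rewrite rinv].
Qed.

Lemma totally_bounded_setU (A B : set G) : totally_bounded A ->
  totally_bounded B -> totally_bounded (A `|` B).
Proof.
move=> tA tB e e0; have [s sA] := tA e e0; have [t tB'] := tB e e0.
by exists (s ++ t) => x [/sA|/tB'] [y ys xy]; exists y; rewrite // mem_cat ys ?orbT.
Qed.

(** By recursion, [K k] is moved away from [C k], the union of the translates already placed, which
    is again totally bounded. *)
Lemma separating_translations (K : nat -> set G) : ~ totally_bounded [set: G] ->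
  (forall k, totally_bounded (K k)) -> exists (r : nat -> G) (e : R), 0 < e /\
    forall j k x y, j != k -> K j x -> K k y ->
      e <= mdist (x * r j)%g (y * r k)%g.
Proof.
move=> /translate_away[e e0 away] tK.
(* The choice is made for all pairs of sets, with default translation [1], because [C] is defined by
   recursion from [pick] before it is known to be totally bounded. *)
have /choice[pick pickP] (AB : set G * set G) : exists r : G,
    totally_bounded AB.1 -> totally_bounded AB.2 ->
    forall x y, AB.1 x -> AB.2 y -> e <= mdist (x * r)%g y.
  have [[tA tB]|nt] := pselect (totally_bounded AB.1 /\ totally_bounded AB.2).
    by have [r rP] := away _ _ tA tB; exists r.
  by exists 1%g => tA tB; case: nt.
pose fix C k : set G := if k is j.+1 then
  C j `|` [set (x * pick (K j, C j))%g | x in K j] else set0.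
pose r k := pick (K k, C k).
have tC k : totally_bounded (C k).
  elim: k => [|k IH]; first by move=> a _; exists [::].
  by apply: totally_bounded_setU => //; exact: totally_bounded_rtrans.
have CK j k x : (j < k)%N -> K j x -> C k (x * r j)%g.
  move=> + Kx; elim: k => // k IH; rewrite ltnS leq_eqVlt => /predU1P[jk|/IH]; last by left.
  by rewrite -jk; right; exists x.
exists r, e; split => // j k x y; rewrite neq_ltn => /orP[jk|kj] Kx Ky.
  rewrite metric_sym.
  exact: (pickP (K k, C k) (tK k) (tC k) _ _ Ky (CK _ _ _ jk Kx)).
exact: (pickP (K j, C j) (tK j) (tC j) _ _ Kx (CK _ _ _ kj Ky)).
Qed.

(* If [G] is totally bounded, the extensions have a uniform ultralimit and no
   translation is needed; otherwise the [K k] can be translated apart, and one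
   extension handles all of them. *)
Lemma common_extension (U : set_system nat) (UU : UltraFilter U)
    (K : nat -> set G) : (forall k, totally_bounded (K k)) ->
  exists r : nat -> G, forall (M : R) (F : nat -> G -> R), 0 <= M ->
    (forall k x, K k x -> `|F k x| <= M) ->
    (forall k x y, K k x -> K k y -> `|F k x - F k y| <= mdist x y) ->
    exists (L : R) (f : G -> R), [/\ lipschitz_with L f, forall x, `|f x| <= M &
      forall e : R, 0 < e -> \forall k \near U,
        forall x, K k x -> `|f (x * r k)%g - F k x| <= e].
Proof.
move=> tK; have [tG|ntG] := pselect (totally_bounded [set: G]).
  exists (fun=> 1%g) => M F M0 FM lF.
  have /choice[E EP] k : exists f : G -> R, [/\ lipschitz_with 1 f,
      forall x, `|f x| <= M & forall x, K k x -> f x = F k x].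
    apply: lipschitz_extension => //; first exact: FM.
    by move=> x y Kx Ky; rewrite mul1r; exact: lF.
  have [||||f [lf fM Ef]] := @lipschitz_ultralimit _ _ UU G 1 M E => //.
  - by move=> k; have [] := EP k.
  - by move=> k; have [] := EP k.
  exists 1, f; split => // e e0; apply: filterS (Ef e e0) => k fE x Kx.
  by have [_ _ <-//] := EP k; rewrite mulg1 distrC; exact: fE.
have [r [d [d0 rP]]] := separating_translations ntG tK.
(* Slope 1 suffices within one translate; across two translates the values differ by at most [2 * M]
   over a distance of at least [d]. *)
exists r => M F M0 FM lF; pose L := 1 + 2 * M / d.
have L0 : 0 <= L by rewrite addr_ge0// divr_ge0 ?mulr_ge0// ltW.
pose at_ k : set G := [set z | K k (z * (r k)^-1)%g].
have at_uniq j k z : at_ j z -> at_ k z -> j = k.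
  move=> Kj Kk; apply/eqP/negP => /negP jk; have := rP j k _ _ jk Kj Kk.
  by rewrite !mulgVK mdistxx leNgt d0.
(* The index of the translate containing [z], unique by separation. The default [0] occurs only off
   all translates, where the values of [F'] do not matter. *)
pose kk z := xget 0%N [set k | at_ k z].
have kkE k z : at_ k z -> kk z = k.
  by move=> Kz; apply: (at_uniq _ _ z) => //; exact: (xgetI 0%N (Kz : [set k | at_ k z] k)).
pose F' z := F (kk z) (z * (r (kk z))^-1)%g.
have [||||f [lf fM fE]] := @lipschitz_extension _ G L M (\bigcup_k at_ k) F' => //.
- by move=> z [k _ Kz]; rewrite /F' (kkE k z Kz); exact: FM.
- move=> x y [j _ Kx] [k _ Ky]; rewrite /F' (kkE j x Kx) (kkE k y Ky).
  have [jk|jk] := eqVneq j k.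
    move: Ky; rewrite -jk => Ky; apply: le_trans (lF _ _ _ Kx Ky) _.
    rewrite rinv /L mulrDl mul1r lerDl mulr_ge0 ?mdist_ge0//.
    by rewrite divr_ge0 ?mulr_ge0// ltW.
  have := rP j k _ _ jk Kx Ky; rewrite !mulgVK => dxy.
  rewrite (le_trans (ler_normB _ _))// (le_trans (lerD (FM _ _ Kx) (FM _ _ Ky)))//.
  rewrite /L mulrDl mul1r ler_wpDl ?mdist_ge0//.
  rewrite (_ : M + M = 2 * M / d * d); last by rewrite divfK ?gt_eqF//; ring.
  rewrite ler_wpM2l// divr_ge0 ?mulr_ge0//.
  exact: ltW.
exists L, f; split => // e e0; apply: filterS filterT => k _ x Kx.
have Kxr : at_ k (x * r k)%g by rewrite /at_ /= mulgK.
rewrite fE; last by exists k.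
by rewrite /F' (kkE k _ Kxr) mulgK subrr normr0 ltW.
Qed.

End mass_transportation.

(** * The invariant embedding, given tracking in both directions *)

Section embedding_of_tracking.
Context {R : realType} {G : metricGroupType R} {X : mmSpace R}.
Hypothesis rinv : right_invariant_metric G.
Context {d} {Om : measurableType d} (P : probability Om R).
Variables (Phi : nat -> Om -> G) (Psi : nat -> Om -> X).
Variables (U : set_system nat) (UU : UltraFilter U).
Hypothesis mPhi : forall k, measurable_fun [set: Om] (Phi k : Om -> borel G).
Hypothesis mPsi : forall k, measurable_fun [set: Om] (Psi k : Om -> borel X).
Hypothesis PPsi : forall k (B : set (borel X)), measurable B ->
  P (Psi k @^-1` B) = mm_measure X B.
Hypothesis Xfull : fully_supported X.
Hypothesis Xcompact : mm_compact X.
Hypothesis Uoo : \oo `<=` U.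
Hypothesis almost_invariant : forall g (f : G -> R), lip1 G f ->
  (forall x, `|f x| <= 1) -> forall e : R, 0 < e -> \forall k \near U,
    `|\int[P]_w f (g * Phi k w)%g - \int[P]_w f (Phi k w)| <= e.
Hypothesis conc_lip1 : forall k (f : G -> R), lip1 G f ->
  exists2 h : X -> R, lip1 X h & close P Phi Psi k k.+1%:R^-1 f h.
Hypothesis conc_lipschitz : forall (L : R) (h : X -> R), lipschitz_with L h ->
  exists f : RUCB R G, tracks P Phi Psi U f h.

Theorem embedding_of_tracking : exists psi : X -> samuel R G,
    [/\ embedding psi,
      invariant_measure
        (pushforward (mm_measure X) (psi : borel X -> borel (samuel R G))) &
      forall g : G, samuel_act g @` range psi = range psi].
Proof.
have /choice[T TP] (f : RUCB R G) :
    exists h : X -> R, continuous h /\ tracks P Phi Psi U f h.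
  have /(rucb_metricP rinv)[[M fM] uf] := rucb_valP f.
  have [h ch fh] := tracks_exists UU mPsi PPsi Xfull Xcompact Uoo conc_lip1 fM uf.
  by exists h.
have Tc f := (TP f).1; have Tt f := (TP f).2.
have Tcst := T_cst rinv UU mPsi PPsi Xfull Tc Tt.
have Tle := @T_le R G X d Om P Phi Psi U UU mPsi PPsi Xfull T Tc Tt.
have Tsub := T_sub UU mPsi PPsi Xfull Tc Tt.
have Tmul := T_mul rinv UU mPsi PPsi Xfull Tc Tt.
have Tmax := T_max rinv UU mPsi PPsi Xfull Tc Tt.
have Tint := T_integral_invariant rinv UU mPhi mPsi PPsi Xfull almost_invariant Tc Tt.
have Tlip (L : R) (h : X -> R) : lipschitz_with L h -> exists f, T f = h.
  move=> lh; have [f fh] := conc_lipschitz lh; exists f.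
  exact: (T_unique UU mPsi PPsi Xfull Tc Tt (lipschitz_continuous lh) fh).
pose psi := character_map Tcst Tsub Tmul.
have psi_orbit g x : exists y, samuel_act g (psi x) = psi y.
  have [y xy] := T_orbit Xfull Xcompact Tc Tcst Tle Tsub Tmul Tmax Tint g x.
  by exists y; apply: samuel_ext => f; exact/esym/xy.
exists psi; split.
- exact: character_map_embedding Tc Tcst Tsub Tmul Tlip.
- apply: psi_invariant => //.
  by move=> L h /Tlip[f fh]; exists f => x; rewrite -fh.
- exact: psi_range.
Qed.

End embedding_of_tracking.

(** * Parametrizations and the distances [me] and [d_conc] *)

Section parametrizations.
Context {R : realType}.
Local Notation lambda := (@lebesgue_measure R).
Local Notation I := (`[0%R, 1%R[%classic : set R).

Lemma measurable_unit_itv : measurable (I : set (measurableTypeR R)).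
Proof. exact: measurable_itv. Qed.

Lemma probability_setI1 d (T : measurableType d) (Q : probability T R)
    (A B : set T) : measurable A -> measurable B -> Q A = 1%E ->
  Q (B `&` A) = Q B.
Proof.
move=> mA mB QA; have mBA : measurable (B `&` A) by exact: measurableI.
have mA' : measurable (~` A) by exact: measurableC.
apply/eqP; rewrite eq_le; apply/andP; split.
  exact: le_measure (mem_set mBA) (mem_set mB) (@subIsetl _ _ _).
have -> : Q (B `&` A) = (Q (B `&` A) + Q (~` A))%E.
  by rewrite probability_setC// QA subee// adde0.
apply: le_trans (measureU2 _ mBA mA').
apply: le_measure; [exact: mem_set|exact/mem_set/measurableU|].
by move=> x Bx; have [Ax|] := pselect (A x); [left|right].
Qed.

Lemma lebesgue_unit_itv : lambda I = 1%E.
Proof. by rewrite lebesgue_measure_itv/= lte01 oppr0 adde0. Qed.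

(** Parametrizations are represented by maps on [R], so the common probability space is all of [R],
    with the complement of [[0, 1)] a null set. *)
Definition unit_itv_measure := mrestr lambda measurable_unit_itv.

HB.instance Definition _ := Measure.on unit_itv_measure.

Let unit_itv_measure_setT : unit_itv_measure setT = 1%E.
Proof. by rewrite /unit_itv_measure /mrestr setTI lebesgue_unit_itv. Qed.

HB.instance Definition _ :=
  Measure_isProbability.Build _ _ _ unit_itv_measure unit_itv_measure_setT.

Lemma measurable_dist_gt (f g : R -> R) (e : R) :
  measurable_fun I f -> measurable_fun I g ->
  measurable (I `&` [set t | `|f t - g t| > e]).
Proof.
move=> mf mg.
have mfg : measurable_fun I (fun t => `|f t - g t|).
  by apply: measurableT_comp => //; exact: measurable_funB.
have -> : [set t | `|f t - g t| > e] = (fun t => `|f t - g t|) @^-1` `]e, +oo[.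
  by apply/seteqP; split => t /=; rewrite in_itv/= andbT.
exact: mfg measurable_unit_itv _ (measurable_itv _).
Qed.

(** Ensures that the infimum defining [me] is over a nonempty set. *)
Lemma me_set1 (f g : R -> R) : measurable_fun I f -> measurable_fun I g ->
  [set e : R | 0 < e /\
    (lambda (I `&` [set t | (`|f t - g t| > e)%R])%classic <= e%:E)%E] 1.
Proof.
move=> mf mg; split => //; rewrite -lebesgue_unit_itv; apply: le_measure.
- by apply: mem_set; exact: measurable_dist_gt.
- by apply: mem_set; exact: measurable_unit_itv.
- by move=> t [].
Qed.

Lemma me_le1 (f g : R -> R) : measurable_fun I f -> measurable_fun I g ->
  me f g <= 1.
Proof.
move=> mf mg; apply: ge_inf; last exact: me_set1.
by exists 0 => e [/ltW].
Qed.

Lemma me_lt (f g : R -> R) (e : R) : measurable_fun I f -> measurable_fun I g ->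
  me f g < e ->
  exists N : set R, [/\ measurable N, (unit_itv_measure N <= e%:E)%E &
    forall t, ~ N t -> I t /\ `|f t - g t| <= e].
Proof.
move=> mf mg fge; have [|e' [e'0 le'] ee'] := @inf_lt R _ e _ fge.
  by exists 1; exact: me_set1.
(* The complement of [[0, 1)] joins the exceptional set at no cost, so that off this set only points
   of [[0, 1)] remain. *)
exists (~` I `|` (I `&` [set t | `|f t - g t| > e'])); split.
- apply: measurableU; last exact: measurable_dist_gt.
  exact: measurableC measurable_unit_itv.
- rewrite /unit_itv_measure /mrestr setIUl setICl set0U setIAC setIid.
  by rewrite (le_trans le')// lee_fin ltW.
- move=> t /not_orP[/contrapT It /not_andP[//|/negP]].
  by rewrite -leNgt => fe; split => //; exact: le_trans fe (ltW ee').
Qed.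

Lemma me_hausdorff_lt (A B : set (R -> R)) (e : R) : A !=set0 -> B !=set0 ->
  (forall f, A f -> measurable_fun I f) ->
  (forall f, B f -> measurable_fun I f) ->
  me_hausdorff A B < e ->
  (forall g, B g -> exists2 f, A f & me f g < e) /\
  (forall f, A f -> exists2 g, B g & me f g < e).
Proof.
move=> [f0 Af0] [g0 Bg0] mA mB ABe.
have [|e' [e'0 BA AB] ee'] := @inf_lt R _ e _ ABe.
  (* The value [2] is admissible because [me] is at most 1, so the infimum is over a nonempty
     set. *)
  exists 2; split => // [g Bg|f Af].
    by exists f0 => //; rewrite (le_lt_trans (me_le1 _ _))// ?ltr1n//; [exact: mA|exact: mB].
  by exists g0 => //; rewrite (le_lt_trans (me_le1 _ _))// ?ltr1n//; [exact: mA|exact: mB].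
split => [g /BA[f Af fg]|f /AB[g Bg fg]]; [exists f|exists g] => //;
  exact: lt_trans fg ee'.
Qed.

(** The infimum in [d_conc] may not be attained, so for each [k] a term [n >= k] and
    parametrizations with error below [1 / (k + 1)] are fixed; limits are later taken over [k]. *)
Lemma concentrates_parametrizations (Y : nat -> mmSpace R) (X : mmSpace R) :
  concentrates Y X -> forall k, exists n phi psi,
  [/\ (k <= n)%N, parametrization (Y n) phi, parametrization X psi,
    forall f, lip1 (Y n) f -> exists2 h, lip1 X h &
      me (f \o phi) (h \o psi) < k.+1%:R^-1 &
    forall h, lip1 X h -> exists2 f, lip1 (Y n) f &
      me (f \o phi) (h \o psi) < k.+1%:R^-1].
Proof.
move=> YX k; have k0 : 0 < k.+1%:R^-1 :> R by rewrite invr_gt0.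
have : \forall n \near \oo, (d_conc (Y n) X < k.+1%:R^-1%:E)%E.
  have : nbhs 0%E [set x : \bar R | (x < k.+1%:R^-1%:E)%E].
    apply: open_nbhs_nbhs; split; last by rewrite /= lte_fin.
    exact: open_ereal_lt_ereal.
  by move=> /YX.
move=> /(filterI (nbhs_infty_ge k))/filter_ex[n [kn]].
move=> /ereal_inf_lt[_ [phi [psi [pphi ppsi ->]]]]; rewrite lte_fin => YXk.
have ne (Z : mmSpace R) : lip1 Z !=set0.
  by exists (fun=> 0) => x y; rewrite subrr normr0 mdist_ge0.
have mlip (Z : mmSpace R) (chi : R -> Z) (f : Z -> R) : parametrization Z chi ->
    lip1 Z f -> measurable_fun I (f \o chi).
  move=> [mchi _] /lip1_lipschitz/lipschitz_continuous/continuous_measurable_borel mf.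
  exact: (measurableT_comp mf mchi).
have [||f|h|XY YX'] := me_hausdorff_lt _ _ _ _ YXk.
- by have [f lf] := ne (Y n); exists (f \o phi), f.
- by have [f lf] := ne X; exists (f \o psi), f.
- by move=> [f' lf' <-]; exact: mlip.
- by move=> [h' lh' <-]; exact: mlip.
exists n, phi, psi; split => // [f lf|h lh].
  by have [|_ [h lh <-] fh] := YX' (f \o phi); [exists f|exists h].
by have [|_ [f lf <-] fh] := XY (h \o psi); [exists h|exists f].
Qed.

End parametrizations.

(** * Concentrating spaces mapped isometrically into the group *)

Section concentration_embedding.
Context {R : realType} {G : metricGroupType R}.
Local Notation I := (`[0%R, 1%R[%classic : set R).
Hypothesis rinv : right_invariant_metric G.
Variable mu : nat -> probability (borel G) R.
Hypothesis cvg_invariance : forall g : G,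
  d_MT (distribution (mu n) (ltrans g)) (mu n) @[n --> \oo] --> (0 : R).
Variables (Y : nat -> mmSpace R) (iota : forall n, Y n -> G).
Hypothesis iota_isometry : forall n (x y : Y n),
  mdist (iota x) (iota y) = mdist x y.
Hypothesis iota_law : forall n (B : set (borel G)), measurable B ->
  mm_measure (Y n) (@iota n @^-1` B) = mu n B.
Hypothesis iota_totally_bounded : forall n, totally_bounded (range (@iota n)).
Variable X : mmSpace R.
Hypothesis Xfull : fully_supported X.
Hypothesis Xcompact : mm_compact X.
Hypothesis conc : concentrates Y X.

Lemma compact_bounded_fun (h : X -> R) : continuous h ->
  exists M, forall x, `|h x| <= M.
Proof.
move=> ch; have [|||y _ ymax] := @compact_EVT_max X R (fun x => `|h x|) setT.
- by exists point.
- exact: Xcompact.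
- by apply: continuous_subspaceT => x; apply: cvg_norm; exact: ch.
by exists `|h y| => x; apply: ymax; exact: mem_set.
Qed.

Lemma iota_continuous n : continuous (@iota n).
Proof.
move=> x; apply/metricType_numDomainType.cvgrPdist_lt => e e0.
have : nbhs x (ball x e) by exact: nbhsx_ballx.
by apply: filterS => y; rewrite ballEmdist iota_isometry.
Qed.

Theorem concentration_embedding : exists psi : X -> samuel R G,
    [/\ embedding psi,
      invariant_measure
        (pushforward (mm_measure X) (psi : borel X -> borel (samuel R G))) &
      forall g : G, samuel_act g @` range psi = range psi].
Proof.
have [U [UU Uoo]] := ultraFilterLemma eventually_filter.
have /choice[n] := concentrates_parametrizations conc.
move=> exphi; pose phi0 k := sval (cid (exphi k)).
have /choice[psi0 phipsi] k := svalP (cid (exphi k)); move: phipsi.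
rewrite -/(phi0 _) => phipsi.
have mI : measurable (I : set (measurableTypeR R)) := measurable_unit_itv.
have [r rP] := common_extension rinv cvg_invariance UU
  (fun k => iota_totally_bounded (n k)).
(* Constant values on the null set outside [[0, 1)] make the maps measurable on all of [R]. *)
pose phi k w : G := if w \in I then iota (phi0 k w) else 1%g.
(* Right translation by [r k] preserves distances and commutes with left translations, so it affects
   neither concentration nor almost invariance. *)
pose Phi k w : G := (phi k w * r k)%g.
pose Psi k w : X := if w \in I then psi0 k w else point.
have mpatch (T : ptopologicalType) (f : R -> T) (c : T) :
    measurable_fun I (f : R -> borel T) ->
    measurable_fun setT ((fun w => if w \in I then f w else c) : R -> borel T).
  move=> mf _ B mB; rewrite setTI.
  have -> : (fun w => if w \in I then f w else c) @^-1` B =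
      (I `&` f @^-1` B) `|` (~` I `&` (setT `&` (fun=> c) @^-1` B)).
    apply/seteqP; split => t /=.
      case: ifPn => [/set_mem It Bt|/negP nIt Bc]; [by left|right; split => //].
      by move=> It; apply: nIt; exact: mem_set.
    by move=> [[It Bt]|[nIt [_ Bc]]]; [rewrite mem_set|rewrite memNset].
  apply: measurableU; first exact: mf.
  apply: measurableI; first exact: measurableC.
  exact: (measurable_cst (c : borel T)).
have mphi k : measurable_fun [set: R] (phi k : R -> borel G).
  apply: mpatch; have [_ [mphi0 _] _ _ _] := phipsi k.
  exact: (measurableT_comp (continuous_borel (@iota_continuous (n k))) mphi0).
have mPsi k : measurable_fun [set: R] (Psi k : R -> borel X).
  by apply: mpatch; have [_ _ [mpsi0 _] _ _] := phipsi k.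
have mPhi k : measurable_fun [set: R] (Phi k : R -> borel G).
  exact: (measurableT_comp (continuous_borel (@rtrans_continuous G (r k))) (mphi k)).
pose P : probability (measurableTypeR R) R := @unit_itv_measure R.
have restrE (A B : set R) : A `&` I = I `&` B -> P A = lebesgue_measure (I `&` B).
  by move=> AB; rewrite /P /= /unit_itv_measure /mrestr AB.
have PPsi k (B : set (borel X)) : measurable B -> P (Psi k @^-1` B) = mm_measure X B.
  move=> mB; have [_ _ [_ <-//] _ _] := phipsi k; apply: restrE.
  by apply/seteqP; split => t /= [+ +] => [BP It|It BP]; split => //;
    move: BP; rewrite /Psi mem_set.
have Pphi k (B : set (borel G)) : measurable B -> P (phi k @^-1` B) = mu (n k) B.
  move=> mB; rewrite -iota_law//.
  have miB : measurable (@iota (n k) @^-1` B : set (borel (Y (n k)))).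
    rewrite -[X in measurable X]setTI.
    exact: (continuous_borel (@iota_continuous (n k))).
  have [_ [_ <-//] _ _ _] := phipsi k; apply: restrE.
  by apply/seteqP; split => t /= [+ +] => [BP It|It BP]; split => //;
    move: BP; rewrite /phi mem_set.
have lr (f : G -> R) k : lip1 G f -> lip1 G (fun x => f (x * r k)%g).
  by move=> lf x y; rewrite (le_trans (lf _ _))// rinv.
have mlip (T : mmSpace R) (f : T -> R) (chi : R -> T) : lip1 T f ->
    parametrization T chi -> measurable_fun I (f \o chi).
  move=> /lip1_lipschitz/lipschitz_continuous/continuous_measurable_borel mf [mchi _].
  exact: (measurableT_comp mf mchi).
apply: (@embedding_of_tracking R G X rinv _ _ P Phi Psi U UU) => //.
(* The mass transportation bound is applied to [f (x * r k)], which is again 1-Lipschitz; [k <= n k]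
   turns convergence in [n] into convergence along [U]. *)
- move=> g f lf f1 e e0; have /cvgrPdist_le/(_ e e0)[N _ NP] := cvg_invariance g.
  apply: Uoo; exists N => // k /= Nk; have [kn _ _ _ _] := phipsi k.
  have := NP (n k) (leq_trans Nk kn); rewrite sub0r normrN.
  apply: le_trans; apply: le_trans (ler_norm _).
  have f1' x : `|f (x * r k)%g| <= 1 by exact: f1.
  have := d_MT_ltrans (mu (n k)) g (lr f k lf) f1'.
  have mfr := continuous_measurable_borel
    (lipschitz_continuous ((lip1_lipschitz _).1 (lr f k lf))).
  have mg : measurable_fun [set: borel G] (ltrans g) by exact: measurable_funPT.
  have f1g x : `|f (g * x * r k)%g| <= 1 by exact: f1.
  have -> : \int[mu (n k)]_x f (g * x * r k)%g = \int[P]_w f (g * phi k w * r k)%g.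
    apply: (@Rintegral_law _ _ _ _ (borel G) P (mu (n k)) (phi k)
      (fun x => f (g * x * r k)%g) 1) => //.
    - exact: mphi.
    - exact: Pphi.
    - exact: (measurableT_comp mfr mg).
  have -> : \int[mu (n k)]_x f (x * r k)%g = \int[P]_w f (phi k w * r k)%g.
    apply: (@Rintegral_law _ _ _ _ (borel G) P (mu (n k)) (phi k)
      (fun x => f (x * r k)%g) 1) => //; [exact: mphi|exact: Pphi].
  rewrite (_ : \int[P]_w f (g * Phi k w)%g = \int[P]_w f (ltrans g (phi k w) * r k)%g)//.
  by apply: eq_Rintegral => w _; rewrite /ltrans mulgA.
- move=> k f lf; have [_ pphi ppsi fh _] := phipsi k.
  have lfi : lip1 (Y (n k)) (fun x => f (iota x * r k)%g).
    by move=> x y; rewrite -iota_isometry; exact: lr.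
  have [h lh /me_lt] := fh _ lfi; move=> /(_ (mlip _ _ _ lfi pphi) (mlip _ _ _ lh ppsi)).
  move=> [N [mN PN Nfh]]; exists h => //; exists N; split => // w /Nfh[Iw].
  by rewrite /Phi /Psi /phi mem_set.
- move=> L h lh; pose c := `|L| + 1; have c0 : 0 < c by rewrite ltr_wpDl.
  pose h1 y := c^-1 * h y.
  have lh1 : lip1 X h1.
    apply/lip1_lipschitz; apply: lipschitz_withW (lipschitz_scale c^-1 lh).
    rewrite ger0_norm ?invr_ge0 ?(ltW c0)// ler_pdivrMl// mulr1.
    by rewrite (le_trans (ler_norm _))// lerDl.
  have [M hM] := compact_bounded_fun (lipschitz_continuous ((lip1_lipschitz _).1 lh1)).
  have M0 : 0 <= M := le_trans (normr_ge0 _) (hM point).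
  have exf k : exists f, lip1 (Y (n k)) f /\
      me (f \o phi0 k) (h1 \o psi0 k) < k.+1%:R^-1.
    by have [_ _ _ _ /(_ _ lh1)[f lf fh]] := phipsi k; exists f.
  pose f k := sval (cid (exf k)); have fP k := svalP (cid (exf k)).
  have iota_inj k (x y : Y (n k)) : iota x = iota y -> x = y.
    by move=> xy; apply: mdist_positivity; rewrite -iota_isometry xy mdistxx.
  (* [f k] is carried to the image of [iota] by a chosen inverse, with [point] as default off the
     image. Truncation at [M] gives a bound uniform in [k] and leaves [h1] unchanged. *)
  pose F k z := clamp M (f k (xget point [set x | iota x = z])).
  have FE k x : F k (iota x) = clamp M (f k x).
    congr (clamp M (f k _)); apply: iota_inj.
    exact: (xgetI point (erefl : [set x0 | iota x0 = iota x] x)).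
  have [|||L' [F' [lF' F'M F'F]]] := rP M F => //.
  - by move=> k _ [x _ <-]; rewrite FE clamp_bound.
  - move=> k _ _ [x _ <-] [y _ <-]; rewrite !FE iota_isometry.
    exact: le_trans (clamp_dist _ _ _) ((fP k).1 x y).
  have rF : (fun x => c * F' x) \in @rucb R G.
    apply: (rucb_lipschitz rinv (L := `|c| * L') (M := `|c| * M)).
      exact: lipschitz_scale.
    by move=> x; rewrite normrM ler_wpM2l.
  exists (MkRUCB rF); rewrite (_ : h = fun y => c * h1 y); last first.
    by apply/funext => y; rewrite /h1 mulVKf// gt_eqF.
  apply: (@tracksZ R G X _ _ P Phi Psi U UU c F' h1) => e e0.
  have e20 : 0 < e / 2 by rewrite divr_gt0.
  apply: filterS2 (F'F _ e20) (near_invS Uoo e20) => k F'k ke.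
  have [_ pphi ppsi _ _] := phipsi k.
  have [N [mN PN Nfh]] := me_lt (mlip _ _ _ (fP k).1 pphi) (mlip _ _ _ lh1 ppsi) (fP k).2.
  exists N; split => //.
    rewrite (le_trans PN)// lee_fin (le_trans ke)// ler_pdivrMr//.
    by rewrite ler_peMr ?ler1n// ltW.
  move=> w /Nfh[Iw] /= fhw; rewrite /Phi /Psi /phi mem_set//.
  have := F'k (iota (phi0 k w)) (ex_intro2 _ _ _ Logic.I erefl); rewrite FE => Fw.
  have := le_trans (clamp_dist M _ _) (le_trans fhw ke).
  rewrite [clamp M (h1 _)]clamp_id// => cw.
  move: Fw cw; rewrite !ler_norml => /andP[? ?] /andP[? ?].
  by apply/andP; split; lra.
Qed.

End concentration_embedding.

Theorem theorem1p1 (R : realType) (G : metricGroupType R)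
  (G2 : second_countable (T := G)) (rinv : right_invariant_metric G)
  (mu : nat -> probability (borel G) R)
  (cK : forall n, compact (spt (mu n)))
  (cvg_invariance : forall g : G,
    d_MT (distribution (mu n) (ltrans g)) (mu n) @[n --> \oo] --> (0 : R))
  (X : mmSpace R) (Xfull : fully_supported X) (Xcompact : mm_compact X)
  (conc : concentrates (fun n => mm_spt G2 (cK n)) X) :
  exists psi : X -> samuel R G,
    [/\ embedding psi,
      invariant_measure
        (pushforward (mm_measure X) (psi : borel X -> borel (samuel R G))) &
      forall g : G, samuel_act g @` range psi = range psi].
Proof.
apply: (@concentration_embedding R G rinv mu cvg_invariance
  (fun n => mm_spt G2 (cK n)) (fun n => set_val)) => //.
(* The inclusion of the support has law [mu n], because the support has full measure in a
   second-countable space. *)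
- move=> n B mB; rewrite /= /prob_sub.
  have -> : set_val @` (set_val @^-1` B : set (set_type (spt (mu n)))) = B `&` spt (mu n).
    apply/seteqP; split => [_ [x Bx <-]|x [Bx Kx]].
      by split => //; exact: set_valP.
    by exists (SigSub (mem_set Kx)).
  apply: probability_setI1 => //; last exact: measure_spt.
  exact: closed_borel (@closed_spt _ _ (mu n)).
- move=> n e e0; have [s sK] := compact_totally_bounded (cK n) e0.
  by exists s => _ [x _ <-]; apply: sK; exact: set_valP.
Qed.
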